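(* Let $n\ge 1$ and let $\mathscr{S}=\mathscr{S}(\mathbb{R}^n,\mathbb{R})$. The real Fourier transform, seen as a map between real inner product spaces $$\mathscr{F}_{\mathbb{R}}:(\mathscr{S},\langle\,,\rangle)\to(\mathscr{S},\langle\,,\rangle),$$ is an inner-product-preserving (i.e., unitary) map. That is, for every $f,g\in\mathscr{S}$, $$\langle\mathscr{F}_{\mathbb{R}}[f],\mathscr{F}_{\mathbb{R}}[g]\rangle=\langle f,g\rangle.$$ In particular, for every $f\in\mathscr{S}$, $$\|\mathscr{F}_{\mathbb{R}}[f]\|_2=\|f\|_2,$$ so $\mathscr{F}_{\mathbb{R}}$ is an isometry.
   Context: $\mathscr{S}=\mathscr{S}(\mathbb{R}^n,\mathbb{R})$ is the real vector space of real-valued Schwartz functions on $\mathbb{R}^n$; $\cdot$ in $\mathbf{y}\cdot\mathbf{x}$ is the Euclidean inner product. The real Fourier transform is the linear operator $\mathscr{F}_{\mathbb{R}}:\mathscr{S}\to\mathscr{S}$, $$\mathscr{F}_{\mathbb{R}}[f](\mathbf{y})=\frac{1}{\sqrt{(2\pi)^n}}\int_{\mathbb{R}^n} f(\mathbf{x})\big(\cos(\mathbf{y}\cdot\mathbf{x})-\sin(\mathbf{y}\cdot\mathbf{x})\big)\,d\mathbf{x}.$$ The inner product is $\langle f,g\rangle=\int_{\mathbb{R}^n} f(\mathbf{x})\,g(\mathbf{x})\,d\mathbf{x}$, and $\|\cdot\|_2$ is the norm it induces. *)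

(* Defs.v *)
From HB Require Import structures.
From mathcomp Require Import all_boot all_order all_algebra.
From mathcomp Require Import all_classical all_reals all_analysis.

Set Implicit Arguments.
Unset Strict Implicit.
Unset Printing Implicit Defensive.

Import Order.TTheory GRing.Theory Num.Theory.
Import numFieldNormedType.Exports.

Local Open Scope classical_set_scope.
Local Open Scope ring_scope.

Definition rV_display : Type -> measure_display.
Proof. exact. Qed.

(* 'rV[R]_n carries the sigma-algebra generated by the coordinates (as the
   library does for n.-tuple), i.e. the Borel sigma-algebra of R^n. *)
Section measurable_rV.
Context {R : realType} (n : nat).

Definition coor_rV (i : 'I_n) (x : 'rV[R]_n) : measurableTypeR R := x ord0 i.

Let rV_set0 : g_sigma_preimage coor_rV set0.
Proof. exact: sigma_algebra0. Qed.

Let rV_setC A : g_sigma_preimage coor_rV A -> g_sigma_preimage coor_rV (~` A).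
Proof. exact: sigma_algebraC. Qed.

Let rV_bigcup (F : (set 'rV[R]_n)^nat) :
  (forall i, g_sigma_preimage coor_rV (F i)) ->
  g_sigma_preimage coor_rV (\bigcup_i (F i)).
Proof. exact: sigma_algebra_bigcup. Qed.

HB.instance Definition _ := @isMeasurable.Build (rV_display R)
  'rV[R]_n (g_sigma_preimage coor_rV) rV_set0 rV_setC rV_bigcup.

Lemma measurable_coor_rV (i : 'I_n) :
  measurable_fun [set: 'rV[R]_n] (coor_rV i).
Proof.
move=> _ Y mY; rewrite setTI; apply: sub_sigma_algebra => /=.
rewrite -bigcup_seq/=; exists i => /=; first by rewrite mem_index_enum.
by exists Y => //; rewrite setTI.
Qed.

Lemma measurable_fun_rVP d (T : measurableType d) (f : T -> 'rV[R]_n) :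
  measurable_fun [set: T] f <->
  forall i, measurable_fun [set: T] (coor_rV i \o f).
Proof.
apply: (@iff_trans _ (g_sigma_preimage (fun i => coor_rV i \o f)
                        `<=` measurable)).
  rewrite g_sigma_preimage_comp; split=> [mf A [/= C preC <-]|prefS].
    exact: mf.
  by move=> _ A mA; apply: prefS; exists A.
split=> [mf i|mf].
- move=> _ A mA; apply: mf; apply: sub_sigma_algebra.
  rewrite -bigcup_seq/=; exists i => /=; first by rewrite mem_index_enum.
  by exists A.
- apply: smallest_sub; first exact: sigma_algebra_measurable.
  rewrite -bigcup_seq/=; apply: bigcup_sub => i _.
  by move=> A [B mB <-]; exact: mf.
Qed.

End measurable_rV.

(* R * R^n and R^n.+1 are identified by prepending a coordinate. *)
Section cons_rV.
Context {R : realType} (n : nat).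

Definition cons_rV (p : measurableTypeR R * 'rV[R]_n) : 'rV[R]_n.+1 :=
  \row_i (if unlift ord0 i is Some j then p.2 ord0 j else p.1).

Lemma measurable_cons_rV : measurable_fun setT cons_rV.
Proof.
apply/measurable_fun_rVP => i; rewrite /comp /coor_rV.
under eq_fun do rewrite mxE.
case: unliftP => [j _|_]; last exact: measurable_fst.
by apply: (measurableT_comp (measurable_coor_rV j)); exact: measurable_snd.
Qed.

Definition uncons_rV (x : 'rV[R]_n.+1) : measurableTypeR R * 'rV[R]_n :=
  (x ord0 ord0, \row_j x ord0 (lift ord0 j)).

Lemma measurable_uncons_rV : measurable_fun setT uncons_rV.
Proof.
apply/measurable_fun_pairP; split; first exact: (measurable_coor_rV ord0).
apply/measurable_fun_rVP => j; rewrite /comp /coor_rV.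
under eq_fun do rewrite mxE.
exact: (measurable_coor_rV (lift ord0 j)).
Qed.

Lemma cons_rVK : cancel cons_rV uncons_rV.
Proof.
move=> [x y]; rewrite /uncons_rV mxE unlift_none; congr (_, _).
by apply/rowP => j; rewrite !mxE liftK.
Qed.

Lemma uncons_rVK : cancel uncons_rV cons_rV.
Proof.
by move=> x; apply/rowP => i; rewrite mxE; case: unliftP => [j ->|->] //=;
  rewrite mxE.
Qed.

Variable mu : {sigma_finite_measure set 'rV[R]_n -> \bar R}.

Definition prod_rV : set 'rV[R]_n.+1 -> \bar R :=
  pushforward (@lebesgue_measure R \x mu)%E cons_rV.

Let prod_rV0 : prod_rV set0 = 0%E.
Proof. by rewrite /prod_rV /pushforward preimage_set0 measure0. Qed.

Let prod_rV_ge0 A : (0 <= prod_rV A)%E.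
Proof. exact: (measure_ge0 (@lebesgue_measure R \x mu)%E). Qed.

Let prod_rV_sigma_additive : semi_sigma_additive prod_rV.
Proof.
rewrite /prod_rV; apply: measure_semi_sigma_additive.
exact: measurable_cons_rV.
Qed.

HB.instance Definition _ := isMeasure.Build _ _ _ prod_rV
  prod_rV0 prod_rV_ge0 prod_rV_sigma_additive.

Let prod_rV_sigma_finite : sigma_finite setT prod_rV.
Proof.
have /sigma_finiteP[F [TF ndF Foo]] := sigma_finiteT (@lebesgue_measure R).
have /sigma_finiteP[G [TG ndG Goo]] := sigma_finiteT mu.
exists (fun k => uncons_rV @^-1` (F k `*` G k)).
  rewrite -preimage_bigcup (_ : \bigcup_k _ = setT) ?preimage_setT//.
  apply/seteqP; split => // -[x y] _.
  have [i _ Fix] : (\bigcup_i F i) x by rewrite -TF.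
  have [j _ Gjy] : (\bigcup_i G i) y by rewrite -TG.
  exists (maxn i j) => //; split => /=.
    by move: x Fix; exact/subsetPset/ndF/leq_maxl.
  by move: y Gjy; exact/subsetPset/ndG/leq_maxr.
move=> k; have [mF Fk] := Foo k; have [mG Gk] := Goo k; split.
  rewrite -[X in measurable X]setTI.
  by apply: measurable_uncons_rV => //; exact: measurableX.
rewrite /prod_rV /pushforward -comp_preimage (_ : _ \o _ = id).
  by rewrite preimage_id product_measure1E// lte_mul_pinfty// ge0_fin_numE.
by apply/funext => p; exact: cons_rVK.
Qed.

HB.instance Definition _ := @Measure_isSigmaFinite.Build _ _ _ prod_rV
  prod_rV_sigma_finite.

End cons_rV.

(* Lebesgue measure on R^n: the n-fold product of the one on R. *)
Fixpoint lebesgue_rV {R : realType} (n : nat) :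
    {sigma_finite_measure set 'rV[R]_n -> \bar R} :=
  match n with
  | 0 => dirac (0 : 'rV[R]_0)
  | m.+1 => prod_rV (lebesgue_rV m)
  end.

Lemma lebesgue_rV_box {R : realType} (n : nat)
    (A : 'I_n -> set (measurableTypeR R)) :
  (forall i, measurable (A i)) ->
  lebesgue_rV n [set x | forall i, A i (x ord0 i)] =
  (\prod_(i < n) lebesgue_measure (A i))%E.
Proof.
elim: n A => [|n IHn] A mA.
  rewrite big_ord0 /= diracE mem_set// => -[].
  by [].
rewrite big_ord_recl -(IHn (fun i => A (lift ord0 i)))//.
rewrite -product_measure1E//.
  rewrite /= /prod_rV /pushforward; congr ((_ \x _)%E _).
  apply/seteqP; split => [[x y]/= Axy|[x y] /= [Ax Ay] i].
    split; first by have := Axy ord0; rewrite mxE unlift_none.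
    by move=> i; have := Axy (lift ord0 i); rewrite mxE liftK.
  by rewrite mxE; case: unliftP => [j ->|->].
rewrite [X in measurable X](_ : _ = \bigcap_(i in [set: 'I_n])
  ((@coor_rV R n i) @^-1` A (lift ord0 i))).
  apply: fin_bigcap_measurable => // i _.
  by rewrite -[X in measurable X]setTI; exact: measurable_coor_rV.
by apply/seteqP; split => x /= Hx i *; exact: Hx.
Qed.

Section schwartz.
Context {R : realType} {n : nat}.
Implicit Types (f g : 'rV[R]_n -> R) (x y : 'rV[R]_n).

Definition partial (i : 'I_n) f : 'rV[R]_n -> R := 'D_(delta_mx ord0 i) f.

Definition iter_partial (s : seq 'I_n) f : 'rV[R]_n -> R := foldr partial f s.

(* C^oo: all iterated partial derivatives, in any order, exist and are
   continuous. *)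
Definition smooth f : Prop := forall s : seq 'I_n,
  continuous (iter_partial s f) /\
  forall (i : 'I_n) x, derivable (iter_partial s f) x (delta_mx ord0 i).

(* d^b = d_0^(b 0) ... d_(n-1)^(b (n-1)) *)
Definition mpartial (b : 'I_n -> nat) f : 'rV[R]_n -> R :=
  iter_partial (flatten [seq nseq (b i) i | i <- enum 'I_n]) f.

Definition monomial (a : 'I_n -> nat) x : R := \prod_(i < n) x ord0 i ^+ a i.

Definition schwartz f : Prop := smooth f /\
  forall a b : 'I_n -> nat,
    exists M : R, forall x, `|monomial a x * mpartial b f x| <= M.

Definition dotrV x y : R := \sum_(i < n) x ord0 i * y ord0 i.

Definition real_fourier f : 'rV[R]_n -> R := fun y =>
  (Num.sqrt ((2 * pi) ^+ n))^-1 *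
  \int[lebesgue_rV n]_x (f x * (cos (dotrV y x) - sin (dotrV y x))).

Definition inner_product f g : R := \int[lebesgue_rV n]_x (f x * g x).

Definition norm2 f : R := Num.sqrt (inner_product f f).

End schwartz.

(* Main.v *)
(* Write T_phi h (y) for the integral of h(x) cos(y.x + phi).  Differentiating
   T_phi h in y_i multiplies h by x_i, and integrating by parts turns
   multiplication by y_i into differentiation of h, each time with a phase shift
   by pi/2; hence the transform preserves the Schwartz class.  Fubini makes it
   self-adjoint, so Plancherel reduces to the pointwise inversion F F g = g.
   For inversion, damp F g by the Gaussian exp(-e^2 |y|^2).  Self-adjointness
   turns the damped integral into the average of g against a probability
   density of width e around x (the transform of a Gaussian is computed from
   the first-order differential equation it satisfies), so it is within O(e) of
   g(x) because g is Lipschitz; and damping costs only O(e^2) because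
   1 - exp(-u) <= u and |y|^2 F g is integrable. *)
Require Import Defs.
From mathcomp Require Import all_boot all_order all_algebra.
From mathcomp Require Import all_classical all_reals all_analysis.
From mathcomp Require Import measurable_realfun ring lra.

Set Implicit Arguments.
Unset Strict Implicit.
Unset Printing Implicit Defensive.

Import Order.TTheory GRing.Theory Num.Theory.
Import numFieldNormedType.Exports.

Local Open Scope classical_set_scope.
Local Open Scope ring_scope.

(** * Lebesgue measure on R^n *)

(** [smooth] speaks only of derivatives along coordinate directions, so the calculus takes place on
    coordinate lines. The derivative of the transform comes from an explicit bound on the
    first-order remainder of the kernel: being an inequality, it can be integrated in [x]. Inversion
    is quantitative in the same way: both errors carry explicit rates in [e], and one small choice
    of [e] concludes. Integrability of decaying functions rests on a single majorant, the inverse of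
    prod_i (1 + x_i^2), which splits along the product structure of the measure. The transform is
    its own inverse, with no reflection, because for cas = cos - sin one has cas(z.y) cas(x.y) =
    cos((z - x).y) - sin((z + x).y). Against an even Gaussian in [y] the sine term vanishes, and the
    cosine term leaves a bump centred at z = x. *)

Section rV_measure.
Context {R : realType}.

(** The sigma-algebra is generated by the coordinates, so the topology enters through boxes: an open
    set is the union of the countably many boxes with rational centre and radius [1/(k+1)] that it
    contains. *)
Lemma open_measurable_rV n (U : set 'rV[R]_n) : open U -> measurable U.
Proof.
move=> oU.
pose box (p : 'rV[rat]_n * nat) : set 'rV[R]_n :=
  [set x | forall i, ball (ratr (p.1 ord0 i) : R) p.2.+1%:R^-1 (x ord0 i)].
have mbox p : measurable (box p).
  rewrite (_ : box p = \bigcap_(i in [set: 'I_n])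
      (coor_rV i @^-1` ball (ratr (p.1 ord0 i) : R) p.2.+1%:R^-1)).
    apply: fin_bigcap_measurable => // i _.
    rewrite -[X in measurable X]setTI; apply: measurable_coor_rV => //.
    by rewrite ball_itv; exact: measurable_itv.
  by apply/seteqP; split => x /= Hx i *; exact: Hx.
(* Boxes that leave [U] become empty, which keeps the union indexed by a whole countable type. *)
rewrite (_ : U = \bigcup_p (if `[<box p `<=` U>] then box p else set0)).
  apply: countable_bigcupT_measurable => // p.
  by case: ifP.
apply/seteqP; split => [x Ux|x [p _]]; last first.
  by case: asboolP => // + bx; exact.
have /nbhs_ballP[e /= e0 xeU] : nbhs x U by exact: open_nbhs_nbhs.
(* Half of [e], because [x] and any other point of the box are each within this radius of its
   centre. *)
have [k ke] : exists k, k.+1%:R^-1 < e / 2.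
  have e2 : 0 < e / 2 by rewrite divr_gt0.
  have [k _ kP] := @near_infty_natSinv_lt R (PosNum e2).
  by exists k; exact: (kP k (leqnn k)).
have k0 : 0 < k.+1%:R^-1 :> R by rewrite invr_gt0.
have [q qx] : exists q : 'rV[rat]_n, forall i,
    ball (ratr (q ord0 i) : R) k.+1%:R^-1 (x ord0 i).
  have qi i : exists q : rat, ball (ratr q : R) k.+1%:R^-1 (x ord0 i).
    have [|q qab] := @rat_in_itvoo R (x ord0 i - k.+1%:R^-1) (x ord0 i + k.+1%:R^-1).
      by rewrite ltrD2l gtrN.
    exists q; move: qab; rewrite in_itv => /= /andP[qa qb].
    by rewrite /ball/= ltr_distl qb ltrBlDr -ltrBlDr qa.
  exists (\row_i projT1 (cid (qi i))) => i.
  by rewrite mxE; exact: projT2 (cid (qi i)).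
exists (q, k) => //.
have -> : `[<box (q, k) `<=` U>]; last by move=> i /=; exact: qx.
apply/asboolP => y /= yb; apply: xeU; split => // i j.
rewrite (ord1 i); apply: (@ball_splitr R R (ratr (q ord0 j) : R)).
  by apply: le_ball (qx j); exact: ltW.
by apply: le_ball (yb j); exact: ltW.
Qed.

Lemma continuous_rV_measurable n (f : 'rV[R]_n -> R) :
  continuous f -> measurable_fun setT f.
Proof.
move=> cf; apply: (measurability _ (RGenOpens.measurableE R)).
move=> _ [_ [a [b ->] <-]]; rewrite setTI; apply: open_measurable_rV.
by apply: open_comp => [x _|]; [exact: cf|exact: interval_open].
Qed.

End rV_measure.

(** * Fubini on R^n by splitting off the first coordinate, and an integrable majorant *)

Section rV_fubini.
Context {R : realType}.

Lemma ge0_integral_rVS n (f : 'rV[R]_n.+1 -> \bar R) :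
  measurable_fun setT f -> (forall x, 0 <= f x)%E ->
  (\int[lebesgue_rV n.+1]_x f x =
   \int[lebesgue_measure]_t \int[lebesgue_rV n]_x f (cons_rV (t, x)))%E.
Proof.
move=> mf f0.
rewrite /= /prod_rV ge0_integral_pushforward//; last exact: measurable_cons_rV.
rewrite preimage_setT fubini_tonelli1//=.
by apply: measurableT_comp => //; exact: measurable_cons_rV.
Qed.

Lemma integrable_cons_rV n (f : 'rV[R]_n.+1 -> \bar R) :
  (lebesgue_rV n.+1).-integrable setT f ->
  (lebesgue_measure \x lebesgue_rV n)%E.-integrable setT (f \o @cons_rV R n).
Proof.
move=> /integrableP[mf fy]; apply/integrableP; split.
  by apply: measurableT_comp => //; exact: measurable_cons_rV.
move: fy; rewrite /= /prod_rV ge0_integral_pushforward ?preimage_setT//.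
  exact: measurable_cons_rV.
exact: measurableT_comp.
Qed.

Lemma integral_rVS_prod n (f : 'rV[R]_n.+1 -> \bar R) :
  (lebesgue_rV n.+1).-integrable setT f ->
  (\int[lebesgue_rV n.+1]_x f x =
   \int[lebesgue_measure \x lebesgue_rV n]_z f (cons_rV z))%E.
Proof.
move=> fi; rewrite /= /prod_rV integral_pushforward ?preimage_setT//.
- exact: measurable_cons_rV.
- exact: measurable_int fi.
- exact: integrable_cons_rV.
Qed.

Lemma integral_rVS n (f : 'rV[R]_n.+1 -> \bar R) :
  (lebesgue_rV n.+1).-integrable setT f ->
  (\int[lebesgue_rV n.+1]_x f x =
   \int[lebesgue_measure]_t \int[lebesgue_rV n]_x f (cons_rV (t, x)))%E.
Proof.
move=> fi; rewrite integral_rVS_prod//.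
by rewrite -integral12_prod_meas1//; exact: integrable_cons_rV.
Qed.

(** Puts the first coordinate innermost, the order required when the integrand is a derivative in
    that coordinate. *)
Lemma integral_rVS_sym n (f : 'rV[R]_n.+1 -> \bar R) :
  (lebesgue_rV n.+1).-integrable setT f ->
  (\int[lebesgue_rV n.+1]_x f x =
   \int[lebesgue_rV n]_x \int[lebesgue_measure]_t f (cons_rV (t, x)))%E.
Proof.
move=> fi; rewrite integral_rVS_prod//.
by rewrite -integral21_prod_meas1//; exact: integrable_cons_rV.
Qed.

Lemma cons_rV0 n (t : R) (x : 'rV[R]_n) : cons_rV (t, x) ord0 ord0 = t.
Proof. by rewrite mxE unlift_none. Qed.

Lemma cons_rV_lift n (t : R) (x : 'rV[R]_n) i :
  cons_rV (t, x) ord0 (lift ord0 i) = x ord0 i.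
Proof. by rewrite mxE liftK. Qed.

Lemma measurable_prod_rV n (h : 'I_n -> R -> R) :
  (forall i, measurable_fun setT (h i)) ->
  measurable_fun setT (fun x : 'rV[R]_n => \prod_i h i (x ord0 i)).
Proof.
move=> mh; apply: measurable_prod => i _.
exact: (measurableT_comp (mh i) (measurable_coor_rV i)).
Qed.

Lemma ge0_integral_prod_rV n (h : 'I_n -> R -> R) :
  (forall i, measurable_fun setT (h i)) -> (forall i t, 0 <= h i t) ->
  (\int[lebesgue_rV n]_x (\prod_i h i (x ord0 i))%:E =
   \prod_i \int[lebesgue_measure]_t (h i t)%:E)%E.
Proof.
elim: n h => [|n IHn] h mh h0.
  rewrite big_ord0 /= integral_dirac//.
    by rewrite diracT mul1e big_ord0.
  by under eq_fun do rewrite big_ord0; exact: measurable_cst.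
rewrite ge0_integral_rVS; last 2 first.
  by apply/measurable_EFinP; exact: measurable_prod_rV.
  by move=> x; rewrite lee_fin prodr_ge0.
rewrite big_ord_recl.
transitivity (\int[lebesgue_measure]_t ((h ord0 t)%:E *
    \prod_(i < n) \int[lebesgue_measure]_t (h (lift ord0 i) t)%:E))%E.
  apply: eq_integral => t _; rewrite -(IHn (fun i => h (lift ord0 i)))//.
  rewrite -ge0_integralZl//; last 3 first.
  - apply/measurable_EFinP.
    exact: (measurable_prod_rV (fun i => mh (lift ord0 i))).
  - by move=> x _; rewrite lee_fin prodr_ge0.
  - by rewrite lee_fin.
  apply: eq_integral => x _; rewrite -EFinM big_ord_recl cons_rV0.
  by congr (_ * _)%:E; apply: eq_bigr => i _; rewrite cons_rV_lift.
rewrite ge0_integralZr//.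
- by apply/measurable_EFinP; exact: mh.
- by move=> t _; rewrite lee_fin.
- by apply: prode_ge0 => i _; apply: integral_ge0 => t _; rewrite lee_fin.
Qed.

Lemma integral_invDsqr :
  (\int[lebesgue_measure]_t ((1 + t ^+ 2)^-1)%:E = (pi : R)%:E)%E.
Proof.
rewrite (@ge0_symfun_integralT R (fun t => (1 + t ^+ 2)^-1)).
- rewrite (_ : [set x | 0 <= x] = `[0, +oo[%classic).
    by rewrite integral0y_oneDsqr -EFinM mulrC divfK.
  by apply/seteqP; split => x /=; rewrite in_itv/= andbT.
- by move=> t; rewrite invr_ge0 addr_ge0// sqr_ge0.
- exact: continuous_oneDsqrV.
- by move=> t /=; rewrite sqrrN.
Qed.

Lemma continuous_oneDsqr_inv : continuous (fun t : R => (1 + t ^+ 2)^-1).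
Proof. exact: continuous_oneDsqrV. Qed.

(** A product instead of [1 + |x|^2]: its inverse factors over the coordinates, hence has the finite
    integral [pi ^ n] in every dimension, and it restricts well to slices. It is still a polynomial,
    so rapid decay absorbs it. *)
Definition weight n (x : 'rV[R]_n) : R := \prod_i (1 + x ord0 i ^+ 2).

Lemma weight_ge1 n (x : 'rV[R]_n) : 1 <= weight x.
Proof.
by rewrite /weight; elim/big_ind: _ => //[a b|i _];
  [exact: mulr_ege1|rewrite lerDl sqr_ge0].
Qed.

Lemma weight_gt0 n (x : 'rV[R]_n) : 0 < weight x.
Proof. exact: lt_le_trans ltr01 (weight_ge1 x). Qed.

Lemma weight_cons n t (x : 'rV[R]_n) :
  weight (cons_rV (t, x)) = (1 + t ^+ 2) * weight x.
Proof.
rewrite /weight big_ord_recl cons_rV0.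
by congr (_ * _); apply: eq_bigr => i _; rewrite cons_rV_lift.
Qed.

Lemma integrable_weightV n :
  (lebesgue_rV n).-integrable setT (fun x => ((weight x)^-1)%:E).
Proof.
have mi : measurable_fun setT (fun t : R => (1 + t ^+ 2)^-1).
  by apply: continuous_measurable_fun; exact: continuous_oneDsqr_inv.
have i0 (t : R) : 0 <= (1 + t ^+ 2)^-1 by rewrite invr_ge0 addr_ge0// sqr_ge0.
apply/integrableP; split.
  apply/measurable_EFinP; under eq_fun do rewrite /weight -prodfV.
  exact: (measurable_prod_rV (fun=> mi)).
under eq_integral do rewrite gee0_abs ?lee_fin ?invr_ge0 ?(ltW (weight_gt0 _))//
  /weight -prodfV.
rewrite (ge0_integral_prod_rV (fun=> mi))//.
under eq_bigr do rewrite integral_invDsqr.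
by rewrite prodEFin ltry.
Qed.

End rV_fubini.

(** * Differential calculus in coordinates *)

Section calculus.
Context {R : realType}.

(** A directional derivative depends only on the restriction to one line, so it can be carried to
    another space where the restriction is the same function of [h]. *)
Lemma is_derive_transfer (V W : normedModType R) (f : V -> R) (g : W -> R)
    (a v : V) (b w : W) (l : R) :
  (forall h : R, f (h *: v + a) = g (h *: w + b)) ->
  is_derive a v f l -> is_derive b w g l.
Proof.
move=> fg [df fl].
have E : (fun h : R => h^-1 *: ((f \o shift a) (h *: v) - f a)) =
         (fun h : R => h^-1 *: ((g \o shift b) (h *: w) - g b)).
  apply/funext => h /=; rewrite fg; congr (_ *: (_ - _)).
  by have := fg 0; rewrite !scale0r !add0r.
by split; rewrite /derivable /derive -E.
Qed.

Lemma bounded_derive_lipschitz (f df : R -> R) (L : R) :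
  (forall x : R, is_derive x 1 f (df x)) -> (forall x, `|df x| <= L) ->
  forall a b, `|f a - f b| <= L * `|a - b|.
Proof.
move=> fdf dfL a b; wlog ba : a b / b <= a => [H|].
  have [/H//|/ltW /H] := leP b a.
  by rewrite distrC (distrC b).
have [|c _ ->] := MVT_segment ba (fun x _ => fdf x).
  by apply: derivable_within_continuous => x _; exact: ex_derive.
by rewrite normrM ler_wpM2r.
Qed.

(** The difference quotient is within [K * |t|] of [l]. Stated as a global bound in [t], the
    hypothesis survives integration over a parameter. *)
Lemma is_derive_quadratic (V : normedModType R) (f : V -> R) (a v : V) (l K : R) :
  (forall t : R, `|f (t *: v + a) - f a - t * l| <= K * t ^+ 2) ->
  is_derive a v f l.
Proof.
move=> fK.
suff cl : h^-1 *: ((f \o shift a) (h *: v) - f a) @[h --> (0:R)^'] --> l.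
  by split; [apply/cvg_ex; exists l | exact: cvg_lim cl].
apply/cvgrPdist_le => e e0; near=> h.
have h0 : h != 0 by near: h; exact: nbhs_dnbhs_neq.
rewrite /= /GRing.scale/= distrC.
have -> : h^-1 * (f (h *: v + a) - f a) - l = h^-1 * (f (h *: v + a) - f a - h * l).
  by field.
rewrite normrM normfV ler_pdivrMl ?normr_gt0// (le_trans (fK h))//.
rewrite -(real_normK (num_real h)) expr2 mulrA mulrC ler_wpM2l//.
(* [K] may be zero or negative; [|K| + 1] is a safe divisor. *)
apply: (@le_trans _ _ ((`|K| + 1) * `|h|)).
  by rewrite ler_wpM2r// (le_trans (ler_norm K))// lerDl.
rewrite -ler_pdivlMl ?ltr_wpDl// mulrC.
near: h; apply: dnbhs0_le; rewrite divr_gt0// ltr_wpDl//.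
Unshelve. all: by end_near. Qed.

Lemma sin_lipschitz (a b : R) : `|sin a - sin b| <= `|a - b|.
Proof.
rewrite -[leRHS]mul1r.
by apply: (bounded_derive_lipschitz (df := cos)) => x; exact: cos_max.
Qed.

(** Mean value theorem for [f]: the derivative at the intermediate [c] is at most [|c| <= |h|]
    because sine is 1-Lipschitz, which yields the constant 1 where Taylor's formula would give
    1/2. *)
Lemma cos_taylor1 (a h : R) : `|cos (a + h) - cos a + h * sin a| <= h ^+ 2.
Proof.
pose f (t : R) := cos (a + t) + t * sin a.
pose df (t : R) := sin a - sin (a + t).
have dF (t : R) : is_derive t 1 f (df t).
  rewrite /f /df; apply: is_derive_eq.
  by rewrite /GRing.scale/=; ring.
have [c ch E] : exists2 c, `|c| <= `|h| & f h - f 0 = df c * h.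
  have [h0|h0] := leP 0 h.
    have [|c + E] := MVT_segment h0 (fun x _ => dF x).
      by apply: derivable_within_continuous => x _; exact: ex_derive.
    rewrite in_itv/= => /andP[c0 ch]; exists c; last by rewrite E subr0.
    by rewrite !ger0_norm.
  have [|c + E] := MVT_segment (ltW h0) (fun x _ => dF x).
    by apply: derivable_within_continuous => x _; exact: ex_derive.
  rewrite in_itv/= => /andP[c0 ch]; exists c.
    by rewrite !ler0_norm ?lerN2// ltW.
  by rewrite -opprB E; ring.
have -> : cos (a + h) - cos a + h * sin a = f h - f 0.
  by rewrite /f addr0; ring.
rewrite E normrM -(real_normK (num_real h)) expr2 ler_wpM2r// /df.
by apply: le_trans (sin_lipschitz _ _) _; rewrite opprD addNKr normrN.
Qed.

Lemma is_derive_cons0 n (f : 'rV[R]_n.+1 -> R) (t : R) (x : 'rV[R]_n) l :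
  is_derive (cons_rV (t, x)) (delta_mx ord0 ord0) f l ->
  is_derive t 1 (fun s => f (cons_rV (s, x))) l.
Proof.
apply: is_derive_transfer => h.
congr f; apply/rowP => i; rewrite !mxE eqxx/=.
case: unliftP => [j ->|->]; first by rewrite mulr0 add0r.
by rewrite eqxx mulr1 /GRing.scale/= mulr1.
Qed.

Lemma is_derive_cons_lift n (f : 'rV[R]_n.+1 -> R) t (x : 'rV[R]_n) i l :
  is_derive (cons_rV (t, x)) (delta_mx ord0 (lift ord0 i)) f l ->
  is_derive x (delta_mx ord0 i) (fun u => f (cons_rV (t, u))) l.
Proof.
apply: is_derive_transfer => h.
congr f; apply/rowP => j; rewrite !mxE eqxx/=.
case: unliftP => [k ->|->]; last by rewrite mulr0 add0r.
by rewrite !mxE eqxx /= (inj_eq lift_inj).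
Qed.

(** Walks from [x] to [y] one coordinate at a time and applies the mean value theorem on each
    segment, whence the l1 distance. With [L = 0] it says that vanishing partial derivatives force a
    constant. *)
Lemma partial_lipschitz n (f : 'rV[R]_n -> R) (df : 'I_n -> 'rV[R]_n -> R) (L : R) :
  (forall i x, is_derive x (delta_mx ord0 i) f (df i x)) ->
  (forall i x, `|df i x| <= L) ->
  forall x y, `|f x - f y| <= L * \sum_i `|x ord0 i - y ord0 i|.
Proof.
elim: n f df => [|n IHn] f df fdf dfL x y.
  have -> : x = y by apply/rowP => -[].
  by rewrite subrr normr0 big_ord0 mulr0.
rewrite -(uncons_rVK x) -(uncons_rVK y).
case: (uncons_rV x) (uncons_rV y) => [s {}x] [t {}y].
(* The corner point: first coordinate already that of [y], the others still those of [x]. *)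
rewrite -(subrK (f (cons_rV (t, x))) (f (cons_rV (s, x)))) -addrA.
apply: le_trans (ler_normD _ _) _.
rewrite big_ord_recl !cons_rV0 mulrDr; apply: lerD.
  apply: (bounded_derive_lipschitz (f := fun u => f (cons_rV (u, x)))
    (df := fun u => df ord0 (cons_rV (u, x)))) => // u.
  exact: is_derive_cons0.
rewrite (eq_bigr (fun i => `|x ord0 i - y ord0 i|)); last first.
  by move=> i _; rewrite !cons_rV_lift.
apply: (IHn (fun u => f (cons_rV (t, u)))
  (fun i u => df (lift ord0 i) (cons_rV (t, u)))) => // i u.
exact: is_derive_cons_lift.
Qed.

Lemma lipschitz_coord_continuous n (f : 'rV[R]_n -> R) (L : R) :
  (forall x y, `|f x - f y| <= L * \sum_i `|x ord0 i - y ord0 i|) ->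
  continuous f.
Proof.
move=> fL x; apply/(@cvgrPdist_le _ _ _ (nbhs x) (nbhs_filter x)) => /= e e0.
pose K := `|L| * n%:R + 1.
have K0 : 0 < K by rewrite ltr_wpDl// mulr_ge0.
have : nbhs x (ball x (e / K)).
  by apply: nbhsx_ballx; rewrite divr_gt0.
apply: (filterS (F := nbhs x)) => y [_ xy]; apply: le_trans (fL _ _) _.
apply: (@le_trans _ _ (`|L| * \sum_(i < n) (e / K))).
  apply: (@le_trans _ _ (`|L| * \sum_i `|x ord0 i - y ord0 i|)).
    by rewrite ler_wpM2r// ?ler_norm// sumr_ge0.
  by rewrite ler_wpM2l// ler_sum// => i _; exact/ltW/xy.
rewrite sumr_const card_ord -mulr_natl.
have -> : `|L| * (n%:R * (e / K)) = e * (`|L| * n%:R / K) by ring.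
rewrite ger_pMr//.
by rewrite ler_pdivrMr// mul1r lerDl.
Qed.

End calculus.

(** * Rapidly decaying functions *)

Lemma integrable_EFinB d (X : measurableType d) (R : realType)
    (mu : {measure set X -> \bar R}) (f g : X -> R) :
  mu.-integrable setT (EFin \o f) -> mu.-integrable setT (EFin \o g) ->
  mu.-integrable setT (EFin \o (fun x => f x - g x)).
Proof. by move=> fi gi; apply: eq_integrable (integrableB measurableT fi gi). Qed.

Lemma integrable_EFinZ d (X : measurableType d) (R : realType)
    (mu : {measure set X -> \bar R}) (c : R) (f : X -> R) :
  mu.-integrable setT (EFin \o f) ->
  mu.-integrable setT (EFin \o (fun x => c * f x)).
Proof. by move=> fi; apply: eq_integrable (integrableZl measurableT c fi). Qed.

Section decaying.
Context {R : realType} {n : nat}.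
Implicit Types (f g h : 'rV[R]_n -> R) (x y : 'rV[R]_n) (i : 'I_n).
Local Notation mu := (lebesgue_rV n).

Lemma rV_continuousD f g : continuous f -> continuous g ->
  continuous (fun x => f x + g x).
Proof. by move=> cf cg x; apply: continuousD; [exact: cf|exact: cg]. Qed.

Lemma rV_continuousM f g : continuous f -> continuous g ->
  continuous (fun x => f x * g x).
Proof. by move=> cf cg x; apply: continuousM; [exact: cf|exact: cg]. Qed.

Lemma rV_continuous_sum (I : Type) (r : seq I) (F : I -> 'rV[R]_n -> R) :
  (forall k, continuous (F k)) -> continuous (fun x => \sum_(k <- r) F k x).
Proof.
move=> cF x.
by apply: (cvg_big (F := nbhs x) (@add_continuous R) (nbhs_filter x)) => k _; exact: cF.
Qed.

(** The share of the Schwartz condition that integral estimates consume: no derivatives. By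
    [schwartzE], a Schwartz function is a smooth one whose iterated partials along ordered words are
    all [decaying]. *)
Definition decaying h := continuous h /\
  forall a : 'I_n -> nat, exists M : R, forall x, `|monomial a x * h x| <= M.

Definition xmul i h x := x ord0 i * h x.

Lemma decaying_xmul i h : decaying h -> decaying (xmul i h).
Proof.
move=> [ch dh]; split.
  by apply: rV_continuousM => //; exact: coord_continuous.
move=> a; have [M hM] := dh (fun j => a j + (j == i))%N; exists M => x.
suff -> : monomial a x * xmul i h x =
    monomial (fun j => a j + (j == i))%N x * h x by [].
rewrite /monomial /xmul; under [in RHS]eq_bigr do rewrite exprD.
rewrite big_split/= [X in _ * X * _](bigD1 i)//= eqxx expr1.
rewrite [X in _ = _ * (_ * X) * _]big1 ?mulr1 ?mulrA//.
by move=> j /negbTE ->.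
Qed.

Lemma decayingD f g : decaying f -> decaying g -> decaying (fun x => f x + g x).
Proof.
move=> [cf df] [cg dg]; split; first exact: rV_continuousD.
move=> a; have [M fM] := df a; have [N gN] := dg a; exists (M + N) => x.
by rewrite mulrDr (le_trans (ler_normD _ _))// lerD.
Qed.

Lemma decayingZ (c : R) f : decaying f -> decaying (fun x => c * f x).
Proof.
move=> [cf df]; split.
  by apply: rV_continuousM => //; exact: cst_continuous.
move=> a; have [M fM] := df a; exists (`|c| * M) => x.
by rewrite mulrCA normrM ler_wpM2l.
Qed.

Lemma decayingM_bounded (K : R) f g : continuous g -> (forall x, `|g x| <= K) ->
  decaying f -> decaying (fun x => f x * g x).
Proof.
move=> cg gK [cf df]; split; first exact: rV_continuousM.
move=> a; have [M fM] := df a; exists (M * K) => x.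
by rewrite mulrA normrM ler_pM.
Qed.

(** One factor at a time: (1 + x_i^2) h = h + x_i (x_i h). *)
Lemma decaying_weight h : decaying h -> decaying (fun x => weight x * h x).
Proof.
move=> dh; rewrite /weight; elim: (index_enum _) => [|i s IHs].
  by under eq_fun do rewrite big_nil mul1r.
under eq_fun => x.
  rewrite big_cons -mulrA mulrDl mul1r expr2 -mulrA.
  over.
by apply: decayingD => //; do 2 apply: decaying_xmul.
Qed.

Lemma decaying_le_weightV h : decaying h ->
  exists M : R, forall x, `|h x| <= M * (weight x)^-1.
Proof.
move=> /decaying_weight[_ /(_ (fun=> 0%N))[M hM]]; exists M => x.
rewrite ler_pdivlMr ?weight_gt0//; have := hM x.
rewrite /monomial; under eq_bigr do rewrite expr0.
by rewrite big1// mul1r normrM (gtr0_norm (weight_gt0 x)) mulrC.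
Qed.

Lemma integrable_le_weightV h (M : R) : continuous h ->
  (forall x, `|h x| <= M * (weight x)^-1) -> mu.-integrable setT (EFin \o h).
Proof.
move=> ch hM.
have := integrableZl measurableT M (integrable_weightV (R := R) n).
apply: le_integrable => //.
- by apply/measurable_EFinP; exact: continuous_rV_measurable.
- by move=> x _; rewrite /= lee_fin (le_trans (hM x)) ?ler_norm.
Qed.

Lemma decaying_integrable h : decaying h -> mu.-integrable setT (EFin \o h).
Proof.
by move=> dh; have [M] := decaying_le_weightV dh; apply: integrable_le_weightV; case: dh.
Qed.

(** * The cosine transform with a phase *)

Lemma dotrVC x y : dotrV x y = dotrV y x.
Proof. by apply: eq_bigr => i _; rewrite mulrC. Qed.

Lemma dotrV_continuous y : continuous (dotrV y).
Proof.
apply: rV_continuous_sum => i.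
by apply: rV_continuousM; [exact: cst_continuous|exact: coord_continuous].
Qed.

Lemma cos_dotrV_continuous phi y : continuous (fun x => cos (dotrV y x + phi)).
Proof.
move=> x; apply: (continuous_comp (f := fun x => dotrV y x + phi)) => //.
  by apply: continuousD; [exact: dotrV_continuous|exact: cst_continuous].
exact: continuous_cos.
Qed.

Lemma decayingM_cos phi y h :
  decaying h -> decaying (fun x => h x * cos (dotrV y x + phi)).
Proof.
apply: (decayingM_bounded (K := 1)); first exact: cos_dotrV_continuous.
by move=> x; exact: cos_max.
Qed.

(* A phase instead of separate sine and cosine transforms: differentiating
   the kernel only shifts [phi] by [pi / 2]. *)
Definition cosT (phi : R) h y : R :=
  \int[mu]_x (h x * cos (dotrV y x + phi)).

Lemma cosT_bound phi h y : decaying h -> `|cosT phi h y| <= \int[mu]_x `|h x|.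
Proof.
move=> dh; have di := decaying_integrable (decayingM_cos phi y dh).
apply: (le_trans (le_normr_Rintegral _ di)) => //.
apply: le_Rintegral => //.
- exact: integrable_norm di.
- exact/integrable_norm/decaying_integrable.
- by move=> x _; rewrite normrM ler_piMr// cos_max.
Qed.

Lemma cosTD phi f g y : decaying f -> decaying g ->
  cosT phi (fun x => f x + g x) y = cosT phi f y + cosT phi g y.
Proof.
move=> df dg; rewrite /cosT -RintegralD//; try
  exact/decaying_integrable/decayingM_cos.
by apply: eq_Rintegral => x _; rewrite mulrDl.
Qed.

Lemma cosTZ phi (c : R) f y : decaying f ->
  cosT phi (fun x => c * f x) y = c * cosT phi f y.
Proof.
move=> df; rewrite /cosT -RintegralZl//; try
  exact/decaying_integrable/decayingM_cos.
by apply: eq_Rintegral => x _; rewrite mulrA.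
Qed.

Lemma dotrV_shift i (t : R) x y :
  dotrV (t *: delta_mx ord0 i + y) x = dotrV y x + t * x ord0 i.
Proof.
rewrite /dotrV [in LHS](eq_bigr (fun j => t * (j == i)%:R * x ord0 j + y ord0 j * x ord0 j)).
  rewrite big_split/= addrC; congr (_ + _).
  rewrite (bigD1 i)//= eqxx mulr1 big1 ?addr0// => j /negbTE ->.
  by rewrite mulr0 mul0r.
by move=> j _; rewrite !mxE eqxx/= mulrDl.
Qed.

(** Moving [y] by [t] along axis [i] moves the angle by [t * x_i], so [cos_taylor1] bounds the
    pointwise remainder by [t^2 * x_i^2 * |h x|]. Its integral is a finite constant times [t^2],
    since [x_i^2 h] decays too. *)
Lemma is_derive_cosT phi h i y : decaying h ->
  is_derive y (delta_mx ord0 i) (cosT phi h) (cosT (phi + pi / 2) (xmul i h) y).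
Proof.
move=> dh; have dx := decaying_xmul i dh; have dxx := decaying_xmul i dx.
apply: (@is_derive_quadratic _ _ _ _ _ _ (\int[mu]_x `|xmul i (xmul i h) x|)) => t.
(* The integrand of the first-order remainder. *)
pose e x := h x * cos (dotrV (t *: delta_mx ord0 i + y) x + phi)
  - h x * cos (dotrV y x + phi)
  - t * (xmul i h x * cos (dotrV y x + (phi + pi / 2))).
have i1 := decaying_integrable (decayingM_cos phi (t *: delta_mx ord0 i + y) dh).
have i2 := decaying_integrable (decayingM_cos phi y dh).
have i3 := decaying_integrable (decayingZ t (decayingM_cos (phi + pi / 2) y dx)).
have i12 := integrable_EFinB i1 i2.
have i4 : mu.-integrable setT (EFin \o e) by exact: integrable_EFinB i3.
have -> : cosT phi h (t *: delta_mx ord0 i + y) - cosT phi h y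
   - t * cosT (phi + pi / 2) (xmul i h) y = \int[mu]_x e x.
  rewrite RintegralB//.
  by rewrite RintegralB// RintegralZl//; exact/decaying_integrable/decayingM_cos.
apply: (le_trans (le_normr_Rintegral _ i4)) => //.
rewrite mulrC -RintegralZl//; last exact/integrable_norm/decaying_integrable.
apply: le_Rintegral => //.
- exact: integrable_norm.
- exact/integrable_EFinZ/integrable_norm/decaying_integrable.
move=> x _; rewrite /e /xmul dotrV_shift addrA cosDpihalf.
set d := dotrV y x.
have -> : h x * cos (d + t * x ord0 i + phi) - h x * cos (d + phi) -
   t * (x ord0 i * h x * - sin (d + phi)) =
   h x * (cos (d + phi + t * x ord0 i) - cos (d + phi) + t * x ord0 i * sin (d + phi)).
  by rewrite (addrAC d); ring.
rewrite normrM; apply: (@le_trans _ _ (`|h x| * (t * x ord0 i) ^+ 2)).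
  by rewrite ler_wpM2l// cos_taylor1.
rewrite !normrM exprMn.
rewrite -(real_normK (num_real (x ord0 i))).
by rewrite le_eqVlt; apply/orP; left; apply/eqP; ring.
Qed.

(** Its partial derivatives are again cosine transforms, bounded uniformly in [y], so the transform
    is even Lipschitz; the sum over [i] is one bound for all directions. *)
Lemma cosT_continuous phi h : decaying h -> continuous (cosT phi h).
Proof.
move=> dh; apply: (@lipschitz_coord_continuous _ _ _
  (\sum_i \int[mu]_x `|xmul i h x|)).
apply: (partial_lipschitz (df := fun i => cosT (phi + pi / 2) (xmul i h))).
  by move=> i x; exact: is_derive_cosT.
move=> i x; rewrite (le_trans (cosT_bound _ _ _))//; first exact: decaying_xmul.
rewrite (bigD1 i)//= lerDl sumr_ge0// => j _.
by apply: Rintegral_ge0.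
Qed.

End decaying.

(** * Integrals of partial derivatives *)

Section integral_of_derivative.
Context {R : realType}.

(** The fundamental theorem is used twice on [[0, +oo[], the second time after reflection, with
    primitive [- G (- x)]. Hence the value at minus infinity is phrased as a limit of [G (- x)]. *)
Lemma ge0_integral_derive (G g : R -> R) (a b : R) :
  (forall x : R, is_derive x 1 G (g x)) -> continuous g -> (forall x, 0 <= g x) ->
  G x @[x --> +oo] --> a -> G (- x) @[x --> +oo] --> b ->
  (\int[lebesgue_measure]_x (g x)%:E = (a - b)%:E)%E.
Proof.
move=> dG cg g0 Ga Gb.
have mg : measurable_fun [set: R] g by exact: continuous_measurable_fun.
have cG : continuous G.
  by move=> x; apply/differentiable_continuous/derivable1_diffP/ex_derive.
have dGN (x : R) : is_derive x 1 (fun x => - G (- x)) (g (- x)).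
  have -> : g (- x) = - (g (- x) * -1) by rewrite mulrN1 opprK.
  by apply: is_deriveN; apply: (is_derive1_comp (f := G) (g := -%R)).
rewrite -(setUv `[0, +oo[%classic) ge0_integral_setU//=; last 4 first.
- exact: measurableC.
- by apply/measurable_EFinP; rewrite setUv.
- by move=> x _; rewrite lee_fin.
- exact/disj_setPCl.
rewrite setCitvr integral_itv_bndo_bndc; last first.
  exact/measurable_EFinP/measurable_funTS.
have -> : (\int[lebesgue_measure]_(x in `]-oo, 0%R]) (g x)%:E =
    \int[lebesgue_measure]_(x in `[0%R, +oo[) ((g \o -%R) x)%:E)%E.
  rewrite -ge0_integration_by_substitutionNy ?oppr0//.
  exact: continuous_subspaceT.
have -> : (\int[lebesgue_measure]_(x in `[0%R, +oo[) (g x)%:E = a%:E - (G 0)%:E)%E.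
  apply: (ge0_continuous_FTC2y _ _ Ga) => //.
  - exact: continuous_subspaceT.
  - by apply: cvg_at_right_filter; exact: cG.
  - by move=> x _; rewrite derive1E; exact: derive_val.
have -> : (\int[lebesgue_measure]_(x in `[0%R, +oo[) ((g \o -%R) x)%:E =
    (- b)%:E - (- G (- 0))%:E)%E.
  apply: (@ge0_continuous_FTC2y _ (g \o -%R) (fun x => - G (- x))) => //=.
  - apply: continuous_subspaceT => x; apply: continuous_comp; last exact: cg.
    exact: opp_continuous.
  - exact: cvgN.
  - by apply: cvg_at_right_filter; apply: cvgN; apply: (continuous_comp (f := -%R));
      [exact: opp_continuous|exact: cG].
  - by move=> x _; rewrite derive1E; exact: derive_val.
by rewrite oppr0 -!EFinB -EFinD; congr EFin; ring.
Qed.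

Lemma cvg_le_oneDsqrV (F : R -> R) (M : R) :
  (forall x, `|F x| <= M * (1 + x ^+ 2)^-1) -> F x @[x --> +oo] --> 0.
Proof.
move=> FM; apply/cvgrPdist_le => e e0; near=> x.
have x1 : 1 <= x by near: x; apply: nbhs_pinfty_ge; rewrite num_real.
have xM : M / e <= x by near: x; apply: nbhs_pinfty_ge; rewrite num_real.
rewrite sub0r normrN (le_trans (FM x))// ler_pdivrMr; last first.
  by rewrite ltr_wpDr ?sqr_ge0.
move: xM; rewrite ler_pdivrMr// => /le_trans; apply.
by rewrite mulrC ler_wpM2l ?ltW//; nra.
Unshelve. all: by end_near. Qed.

(* The fundamental theorem on half-lines needs a nonnegative integrand: it is
   applied to [F + M * atan] and to [M * atan]. *)
Lemma integral_derive_eq0 (F f : R -> R) (M : R) :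
  (forall x : R, is_derive x 1 F (f x)) -> continuous f ->
  (forall x, `|F x| <= M * (1 + x ^+ 2)^-1) ->
  (forall x, `|f x| <= M * (1 + x ^+ 2)^-1) ->
  (\int[lebesgue_measure]_x (f x)%:E = 0)%E.
Proof.
move=> dF cf FM fM.
pose p (x : R) : R := M * (1 + x ^+ 2)^-1.
have p0 x : 0 <= p x by exact: le_trans (normr_ge0 _) (fM x).
have M0 : 0 <= M by have := p0 0; rewrite /p expr0n addr0 invr1 mulr1.
have cp : continuous p.
  by move=> x; apply: cvgM; [exact: cvg_cst|exact: continuous_oneDsqr_inv].
have cvgp : M * atan x @[x --> +oo] --> M * (pi / 2).
  by apply: cvgM; [exact: cvg_cst|exact: cvgy_atan].
have dp (x : R) : is_derive x 1 (fun t => M * atan t) (p x).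
  apply: is_derive_eq; by rewrite /GRing.scale.
have Ip : (\int[lebesgue_measure]_x (p x)%:E = (M * pi)%:E)%E.
  rewrite (@ge0_integral_derive (fun t => M * atan t) p (M * (pi / 2)) (- (M * (pi / 2))))//.
    by congr EFin; field.
  under eq_fun do rewrite atanN mulrN.
  exact: cvgN.
have Ig : (\int[lebesgue_measure]_x (f x + p x)%:E = (M * pi)%:E)%E.
  rewrite (@ge0_integral_derive (fun t => F t + M * atan t) (fun x => f x + p x)
      (0 + M * (pi / 2)) (0 - (M * (pi / 2))))//.
  - by congr EFin; field.
  - by move=> x; apply: cvgD; [exact: cf|exact: cp].
  - by move=> x; rewrite -lerBlDr sub0r; have := fM x; rewrite ler_norml => /andP[fp _]; exact: fp.
  - by apply: cvgD => //; exact: cvg_le_oneDsqrV FM.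
  - apply: cvgD.
      by apply: (@cvg_le_oneDsqrV _ M) => x; rewrite (le_trans (FM _))// sqrrN.
    by under eq_fun do rewrite atanN mulrN; exact: cvgN.
have ip : lebesgue_measure.-integrable setT (EFin \o p).
  apply/integrableP; split; first by apply/measurable_EFinP; exact: continuous_measurable_fun.
  by under eq_integral do rewrite /= ger0_norm//; rewrite Ip ltry.
have i_f : lebesgue_measure.-integrable setT (EFin \o f).
  apply: le_integrable ip => //.
    by apply/measurable_EFinP; exact: continuous_measurable_fun.
  by move=> x _; rewrite /= lee_fin (ger0_norm (p0 x)).
move: Ig; under eq_integral do rewrite EFinD.
rewrite integralD_EFin// Ip.
have /fineK <- := integrable_fin_num measurableT i_f.
by rewrite -EFinD => -[] /(canRL (addrK _)); rewrite subrr => ->.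
Qed.

Lemma cons_rV_continuousl n (x : 'rV[R]_n) :
  continuous (fun t : R => cons_rV (t, x)).
Proof.
move=> t A /nbhs_ballP[e /= e0 eA]; apply/nbhs_ballP; exists e => // s ts.
apply: eA; split => // i j; rewrite !mxE.
by case: unlift => [k|] //; exact: ballxx.
Qed.

Lemma cons_rV_continuousr n (t : R) :
  continuous (fun x : 'rV[R]_n => cons_rV (t, x)).
Proof.
move=> x A /nbhs_ballP[e /= e0 eA]; apply/nbhs_ballP; exists e => // y [_ xy].
apply: eA; split => // i j; rewrite !mxE.
by case: unlift => [k|]; [exact: xy|exact: ballxx].
Qed.

(** Fubini reduces to the line: if [i] is the first coordinate, it is integrated innermost and the
    inner integral vanishes; otherwise the first coordinate is frozen and induction applies to the
    slice. *)
Lemma integral_partial_eq0 n (f df : 'rV[R]_n -> R) (i : 'I_n) (M : R) :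
  (forall x, is_derive x (delta_mx ord0 i) f (df x)) -> continuous df ->
  (forall x, `|f x| <= M * (weight x)^-1) ->
  (forall x, `|df x| <= M * (weight x)^-1) ->
  (\int[lebesgue_rV n]_x (df x)%:E = 0)%E.
Proof.
elim: n f df i M => [|n IHn] f df i M fdf cdf fM dfM; first by case: i {fdf}.
have idf := integrable_le_weightV cdf dfM.
have M0 : 0 <= M.
  by have := le_trans (normr_ge0 _) (fM 0); rewrite pmulr_lge0// invr_gt0 weight_gt0.
have bnd (g : 'rV[R]_n.+1 -> R) t x : `|g (cons_rV (t, x))| <= M * (weight (cons_rV (t, x)))^-1 ->
    `|g (cons_rV (t, x))| <= M * (1 + t ^+ 2)^-1 /\
    `|g (cons_rV (t, x))| <= M * (weight x)^-1.
  rewrite weight_cons => gM.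
  have t1 : 1 <= 1 + t ^+ 2 by rewrite lerDl sqr_ge0.
  have x1 := weight_ge1 x.
  split; apply: (le_trans gM); rewrite ler_wpM2l// lef_pV2 ?posrE ?mulr_gt0//;
    try exact: lt_le_trans ltr01 _.
    by rewrite ler_peMr// ltW// (lt_le_trans ltr01).
  by rewrite ler_peMl// ltW// weight_gt0.
have [j ij|i0] := unliftP ord0 i.
  rewrite integral_rVS// integral0_eq// => t _.
  apply: (IHn (fun x => f (cons_rV (t, x))) _ j M).
  - by move=> x; apply: is_derive_cons_lift; rewrite -ij.
  - move=> x; apply: (continuous_comp (f := fun x => cons_rV (t, x))).
      exact: cons_rV_continuousr.
    exact: cdf.
  - by move=> x; have [] := bnd _ _ _ (fM (cons_rV (t, x))).
  - by move=> x; have [] := bnd _ _ _ (dfM (cons_rV (t, x))).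
rewrite integral_rVS_sym// integral0_eq// => x _.
apply: (@integral_derive_eq0 (fun t => f (cons_rV (t, x))) _ M).
- by move=> t; apply: is_derive_cons0; rewrite -i0.
- move=> t; apply: (continuous_comp (f := fun t => cons_rV (t, x))).
    exact: cons_rV_continuousl.
  exact: cdf.
- by move=> t; have [] := bnd _ _ _ (fM (cons_rV (t, x))).
- by move=> t; have [] := bnd _ _ _ (dfM (cons_rV (t, x))).
Qed.

End integral_of_derivative.

(** * The transform on the Schwartz space *)

Definition fourier_const {R : realType} (n : nat) : R := (Num.sqrt ((2 * pi) ^+ n))^-1.

Section schwartz_transform.
Context {R : realType} {n : nat}.
Implicit Types (f g h : 'rV[R]_n -> R) (x y : 'rV[R]_n) (i j : 'I_n) (s u : seq 'I_n).
Local Notation mu := (lebesgue_rV n).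

Lemma is_derive_cos_dotrV phi i y x :
  is_derive x (delta_mx ord0 i) (fun x => cos (dotrV y x + phi))
    (y ord0 i * cos (dotrV y x + (phi + pi / 2))).
Proof.
apply: (is_derive_quadratic (K := y ord0 i ^+ 2)) => t.
rewrite dotrVC dotrV_shift (dotrVC x) addrA cosDpihalf -exprMn (mulrC _ t).
rewrite (addrAC (dotrV y x)) mulrA mulrN opprK.
exact: cos_taylor1.
Qed.

Lemma cosT_parts phi h dh i y :
  (forall x, is_derive x (delta_mx ord0 i) h (dh x)) ->
  decaying h -> decaying dh ->
  y ord0 i * cosT (phi + pi / 2) h y = - cosT phi dh y.
Proof.
move=> hdh dech decdh.
pose f x := h x * cos (dotrV y x + phi).
pose df x := dh x * cos (dotrV y x + phi) +
  y ord0 i * (h x * cos (dotrV y x + (phi + pi / 2))).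
have fdf x : is_derive x (delta_mx ord0 i) f (df x).
  apply: (is_derive_eq (is_deriveM (hdh x) (is_derive_cos_dotrV phi i y x))).
  by rewrite /df /GRing.scale/=; ring.
have decf : decaying f by exact: decayingM_cos.
have d1 : decaying (fun x => dh x * cos (dotrV y x + phi)) by exact: decayingM_cos.
have d2 : decaying (fun x => y ord0 i * (h x * cos (dotrV y x + (phi + pi / 2)))).
  exact/decayingZ/decayingM_cos.
have decdf : decaying df by exact: decayingD.
have [M fM] := decaying_le_weightV decf.
have [N dfN] := decaying_le_weightV decdf.
have w0 x : 0 <= (weight x)^-1 by rewrite invr_ge0 ltW// weight_gt0.
(* [integral_partial_eq0] takes a single constant for the function and its derivative. *)
have bM x : `|f x| <= (`|M| + `|N|) * (weight x)^-1.
  by rewrite (le_trans (fM x))// ler_wpM2r// (le_trans (ler_norm M))// lerDl.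
have bN x : `|df x| <= (`|M| + `|N|) * (weight x)^-1.
  by rewrite (le_trans (dfN x))// ler_wpM2r// (le_trans (ler_norm N))// lerDr.
have df0 : \int[mu]_x df x = 0.
  by rewrite /Rintegral (integral_partial_eq0 fdf _ bM bN)//; case: decdf.
apply/eqP; rewrite -subr_eq0 opprK addrC; apply/eqP.
rewrite -df0 RintegralD//; try exact: decaying_integrable.
by rewrite RintegralZl//; exact/decaying_integrable/decayingM_cos.
Qed.

(** The list of directions inside [mpartial b]. It also spells out the monomial of exponent [b],
    which permits induction on letters instead of exponents. *)
Definition word (b : 'I_n -> nat) : seq 'I_n :=
  flatten [seq nseq (b i) i | i <- enum 'I_n].

(* Membership in [mpartial]'s fixed order of differentiation; closed under
   subsequences, so that the commutation of partial derivatives is not needed. *)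
Definition ordered s : Prop := exists b, s = word b.

(** A word is a concatenation of constant blocks. The mask is cut at the end of the first block;
    what survives of that block is again constant, and its length is the new exponent. Since the
    enumeration has no repetition, this exponent does not disturb later blocks. *)
Lemma ordered_subseq s u : subseq u s -> ordered s -> ordered u.
Proof.
move=> us [b sb]; move: us; rewrite {}sb /ordered /word.
elim: (enum 'I_n) (enum_uniq 'I_n) u => [_ u|i l IHl /= /andP[il ul] u].
  by rewrite subseq0 => /eqP ->; exists (fun=> 0%N).
move=> /subseqP[m sm ->{u}].
rewrite size_cat in sm.
have sm1 : size (take (size (nseq (b i) i)) m) = size (nseq (b i) i).
  by rewrite size_takel// sm leq_addr.
have [|c cE] := IHl ul (mask (drop (size (nseq (b i) i)) m)
    (flatten [seq nseq (b i) i | i <- l])).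
  exact: mask_subseq.
rewrite -(cat_take_drop (size (nseq (b i) i)) m) mask_cat// cE.
set v := mask _ _.
have vE : v = nseq (size v) i.
  by apply/all_pred1P/allP => z /mem_mask; rewrite mem_nseq => /andP[].
exists (fun j => if j == i then size v else c j).
rewrite /= eqxx -vE; congr (_ ++ flatten _).
by apply/eq_in_map => j jl; case: eqP => // ji; rewrite -ji jl in il.
Qed.

Lemma schwartzE f : schwartz f <->
  smooth f /\ forall s, ordered s -> decaying (iter_partial s f).
Proof.
split=> [[sf fM]|[sf dec]]; split=> //.
  by move=> _ [b ->]; split; [have [] := sf (word b)|move=> a; exact: fM].
by move=> a b; have [_ /(_ a)] := dec (word b) (ex_intro _ b erefl).
Qed.

Lemma ordered0 : ordered [::].
Proof. by exists (fun=> 0%N); rewrite /word; elim: (enum _). Qed.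

Lemma schwartz_decaying f : schwartz f -> decaying f.
Proof. by move=> /schwartzE[_ /(_ _ ordered0)]. Qed.

Lemma smooth_is_derive f s i x : smooth f ->
  is_derive x (delta_mx ord0 i) (iter_partial s f) (iter_partial (i :: s) f x).
Proof. by move=> sf; apply: derivableP; have [_] := sf s; exact. Qed.

Lemma ordered1 i : ordered [:: i].
Proof.
have ii : i \in enum 'I_n by rewrite mem_enum.
apply: (@ordered_subseq (word (fun=> 1%N))); last by exists (fun=> 1%N).
rewrite sub1seq /word; apply/flattenP; exists [:: i]; last exact: mem_head.
by apply/mapP; exists i.
Qed.

Lemma monomial_word (a : 'I_n -> nat) x :
  monomial a x = \prod_(i <- word a) x ord0 i.
Proof.
rewrite /word big_flatten/= big_map /monomial.
rewrite big_enum/=; apply: eq_bigr => i _.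
by rewrite big_nseq; elim: (a i) => [|k IHk]; rewrite ?expr0// exprS IHk.
Qed.

Lemma iter_partialD (c : R) f g s : smooth f -> smooth g ->
  iter_partial s (fun x => c * f x + g x) =
  (fun x => c * iter_partial s f x + iter_partial s g x).
Proof.
move=> sf sg; elim: s => //= i s ->.
apply/funext => x; rewrite /partial.
by case: (is_deriveD (is_deriveZ c (smooth_is_derive s i x sf))
  (smooth_is_derive s i x sg)).
Qed.

Lemma schwartzD (c : R) f g : schwartz f -> schwartz g ->
  schwartz (fun x => c * f x + g x).
Proof.
move=> /schwartzE[sf df] /schwartzE[sg dg]; apply/schwartzE; split.
  move=> s; rewrite iter_partialD//; split.
    apply: rV_continuousD; last by have [] := sg s.
    by apply: rV_continuousM; [exact: cst_continuous|have [] := sf s].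
  move=> i x.
  by case: (is_deriveD (is_deriveZ c (smooth_is_derive s i x sf))
    (smooth_is_derive s i x sg)).
move=> s os; rewrite iter_partialD//.
by apply: decayingD; [apply: decayingZ; exact: df|exact: dg].
Qed.

(** * Multiplication by a coordinate: the Leibniz rule *)

Lemma is_derive_xmul i j g dg x : is_derive x (delta_mx ord0 j) g dg ->
  is_derive x (delta_mx ord0 j) (xmul i g) ((i == j)%:R * g x + x ord0 i * dg).
Proof.
move=> gdg.
have dx : is_derive x (delta_mx ord0 j) (fun x : 'rV[R]_n => x ord0 i) (i == j)%:R.
  apply: (is_derive_quadratic (K := 0)) => t.
  by rewrite !mxE eqxx/= addrK subrr normr0 mul0r.
apply: (is_derive_eq (is_deriveM dx gdg)).
by rewrite /GRing.scale/=; ring.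
Qed.

Lemma is_derive_bigsum (I : eqType) (r : seq I) (F : I -> 'rV[R]_n -> R) (dF : I -> R) x v :
  (forall k, k \in r -> is_derive x v (F k) (dF k)) ->
  is_derive x v (fun y => \sum_(k <- r) F k y) (\sum_(k <- r) dF k).
Proof.
elim: r => [_|k r IHr Fd].
  rewrite big_nil; under eq_fun do rewrite big_nil.
  exact: is_derive_cst.
rewrite big_cons; under eq_fun do rewrite big_cons.
apply: is_deriveD; first by apply: Fd; rewrite mem_head.
by apply: IHr => l lr; apply: Fd; rewrite inE lr orbT.
Qed.

(** The words left after erasing one occurrence of [i] from [s], one for each occurrence. They index
    the correction terms of the Leibniz rule for [x_i f]: the factor [x_i] is differentiated at most
    once, and only by a letter [i]. *)
Fixpoint deletions i s : seq (seq 'I_n) :=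
  if s is j :: s' then
    (if i == j then [:: s'] else [::]) ++ [seq j :: u | u <- deletions i s']
  else [::].

Lemma deletions_subseq i s u : u \in deletions i s -> subseq u s.
Proof.
elim: s u => // j s IHs u /=; rewrite mem_cat => /orP[|/mapP[v /IHs vs ->]].
  by case: eqP => // _; rewrite inE => /eqP ->; exact: subseq_cons.
by rewrite /= eqxx.
Qed.

Lemma is_derive_leibniz i j s f x : smooth f ->
  is_derive x (delta_mx ord0 j)
    (fun x => xmul i (iter_partial s f) x +
       \sum_(u <- deletions i s) iter_partial u f x)
    (xmul i (iter_partial (j :: s) f) x +
       \sum_(u <- deletions i (j :: s)) iter_partial u f x).
Proof.
move=> sf.
apply: (is_derive_eq (is_deriveD (is_derive_xmul i (smooth_is_derive s j x sf))
  (is_derive_bigsum (r := deletions i s) (fun u _ => smooth_is_derive u j x sf)))).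
rewrite /= big_cat/= big_map addrA; congr (_ + _).
rewrite /xmul addrC; congr (_ + _).
by case: eqP => _; rewrite ?mul1r ?mul0r ?big_seq1 ?big_nil.
Qed.

Lemma iter_partial_xmul i s f : smooth f ->
  iter_partial s (xmul i f) = (fun x => xmul i (iter_partial s f) x +
       \sum_(u <- deletions i s) iter_partial u f x).
Proof.
move=> sf; elim: s => [|j s /= ->].
  by apply/funext => x; rewrite big_nil addr0.
by apply/funext => x; case: (is_derive_leibniz i j s x sf).
Qed.

(** The correction terms run over subsequences of an ordered word, which are ordered, so their decay
    is part of the hypothesis on [f]. *)
Lemma schwartz_xmul i f : schwartz f -> schwartz (xmul i f).
Proof.
move=> /schwartzE[sf df]; apply/schwartzE; split.
  move=> s; rewrite iter_partial_xmul//; split.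
    apply: rV_continuousD.
      by apply: rV_continuousM; [exact: coord_continuous|have [] := sf s].
    by apply: rV_continuous_sum => u; have [] := sf u.
  by move=> j x; case: (is_derive_leibniz i j s x sf).
move=> s os; rewrite iter_partial_xmul//; apply: decayingD.
  exact/decaying_xmul/df.
have : {subset deletions i s <= [pred u | subseq u s]}.
  by move=> u; exact: deletions_subseq.
elim: (deletions i s) => [_|u r IHr urs].
  under eq_fun do rewrite big_nil.
  (* The zero function, seen as [0 * f]. *)
  have := decayingZ 0 (df _ ordered0).
  by under eq_fun do rewrite mul0r.
under eq_fun do rewrite big_cons.
apply: decayingD.
  by apply/df/(ordered_subseq _ os)/urs; rewrite mem_head.
by apply: IHr => v vr; apply: urs; rewrite inE vr orbT.
Qed.

(** * Stability of the Schwartz class under the transform *)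

Definition xmuls s f := foldr xmul f s.

Lemma schwartz_xmuls s f : schwartz f -> schwartz (xmuls s f).
Proof. by move=> sf; elim: s => //= i s; exact: schwartz_xmul. Qed.

Lemma iter_partial_cosT phi f s : schwartz f ->
  iter_partial s (cosT phi f) = cosT (phi + (size s)%:R * (pi / 2)) (xmuls s f).
Proof.
move=> sf; elim: s => [|i s /= ->]; first by rewrite mul0r addr0.
apply/funext => y.
have /schwartz_decaying ds := schwartz_xmuls s sf.
case: (is_derive_cosT (phi + (size s)%:R * (pi / 2)) i y ds) => _.
rewrite /partial => ->; congr (cosT _ _ _); rewrite -natr1; ring.
Qed.

(** Each factor [y_i] is traded for one derivative, at the cost of a sign and a phase shift by
    [- pi / 2]. Absolute values hide the sign, and the phase may stay unspecified because
    [cosT_bound] is uniform in it. *)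
Lemma norm_prod_cosT phi h s y : smooth h ->
  (forall u, subseq u s -> decaying (iter_partial u h)) ->
  exists phi', `|(\prod_(i <- s) y ord0 i) * cosT phi h y| =
    `|cosT phi' (iter_partial s h) y|.
Proof.
move=> sh; elim: s => [|i s IHs] dech.
  by exists phi; rewrite big_nil mul1r.
have [u us|psi psiE] := IHs.
  exact/dech/(subseq_trans us)/subseq_cons.
exists (psi - pi / 2); rewrite big_cons -mulrA normrM psiE -normrM.
rewrite -[in LHS](subrK (pi / 2) psi) (cosT_parts _ _ (fun x => smooth_is_derive s i x sh)).
- by rewrite normrN.
- exact/dech/subseq_cons.
- exact: dech.
Qed.

Lemma decaying_cosT phi h : schwartz h -> decaying (cosT phi h).
Proof.
move=> sh; split; first exact/cosT_continuous/schwartz_decaying.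
have /schwartzE[smh dech] := sh.
move=> a; exists (\int[mu]_x `|iter_partial (word a) h x|) => y.
have oa : ordered (word a) by exists a.
have [|psi] := @norm_prod_cosT phi h (word a) y smh.
  by move=> u us; exact/dech/(ordered_subseq us).
by rewrite -monomial_word => ->; apply: cosT_bound; exact: dech.
Qed.

Lemma schwartz_cosT phi h : schwartz h -> schwartz (cosT phi h).
Proof.
move=> sh; apply/schwartzE; split=> s.
  rewrite iter_partial_cosT//.
  have /schwartz_decaying ds := schwartz_xmuls s sh.
  split; first exact: cosT_continuous.
  by move=> i x; case: (is_derive_cosT (phi + (size s)%:R * (pi / 2)) i x ds).
by move=> os; rewrite iter_partial_cosT//; exact/decaying_cosT/schwartz_xmuls.
Qed.

Lemma real_fourierE f y : decaying f ->
  real_fourier f y = fourier_const n * cosT 0 f y + fourier_const n * cosT (pi / 2) f y.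
Proof.
move=> df; rewrite /real_fourier -/(fourier_const n) -mulrDr; congr (_ * _).
rewrite /cosT -RintegralD//; try exact/decaying_integrable/decayingM_cos.
by apply: eq_Rintegral => x _; rewrite cosDpihalf addr0 mulrDr.
Qed.

Lemma schwartz_real_fourier f : schwartz f -> schwartz (real_fourier f).
Proof.
(* [schwartzD] scales only its first summand, so [c * T] is split as [(c - 1) * T + T]. *)
move=> sf; rewrite (_ : real_fourier f = fun y => fourier_const n * cosT 0 f y +
    ((fourier_const n - 1) * cosT (pi / 2) f y + cosT (pi / 2) f y)).
  by do ![apply: schwartzD|exact: schwartz_cosT].
apply/funext => y; rewrite real_fourierE; first by ring.
exact: schwartz_decaying.
Qed.

Lemma real_fourier_linear (a : R) f g y : decaying f -> decaying g ->
  real_fourier (fun x => a * f x + g x) y = a * real_fourier f y + real_fourier g y.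
Proof.
move=> df dg; have daf := decayingZ a df.
rewrite !real_fourierE//; last exact: decayingD.
by rewrite !cosTD// !cosTZ//; ring.
Qed.

End schwartz_transform.

(** * Gaussians *)

Section gaussian.
Context {R : realType} {n : nat}.
Implicit Types (x y z : 'rV[R]_n) (b : R) (i : 'I_n).
Local Notation mu := (lebesgue_rV n).

(** The parameter may have any sign: a negative one provides the integrating factor in
    [cosT_gauss]. *)
Definition gauss b x : R := expR (- (b * \sum_i x ord0 i ^+ 2)).

Lemma gauss_ge0 b x : 0 <= gauss b x. Proof. exact: expR_ge0. Qed.

Lemma gauss_le1 b x : 0 <= b -> gauss b x <= 1.
Proof.
move=> b0; rewrite /gauss -[leRHS]expR0 ler_expR oppr_le0.
by rewrite mulr_ge0// sumr_ge0// => i _; exact: sqr_ge0.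
Qed.

Lemma gauss_prod b x : gauss b x = \prod_i expR (- (b * x ord0 i ^+ 2)).
Proof. by rewrite /gauss mulr_sumr -sumrN expR_sum. Qed.

Lemma gauss_continuous b : continuous (gauss b).
Proof.
move=> x; apply: (continuous_comp (f := fun x => - (b * \sum_i x ord0 i ^+ 2))).
  apply: continuousN; apply: continuousM; first exact: cst_continuous.
  apply: rV_continuous_sum => i {}x.
  by apply: continuousM; exact: coord_continuous.
exact: continuous_expR.
Qed.

Lemma is_derive_gauss b i x :
  is_derive x (delta_mx ord0 i) (gauss b) (- (2 * b * x ord0 i * gauss b x)).
Proof.
(* [gauss b] along the line through [x] in direction [i], where the sum of squares grows by
   [2 * s * x_i + s^2]. *)
pose g (s : R) := gauss b x * expR (- (b * (2 * s * x ord0 i + s ^+ 2))).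
apply: (@is_derive_transfer R R 'rV[R]_n g _ 0 1).
  move=> h; rewrite /g addr0 /GRing.scale/= mulr1 /gauss -expRD -opprD -mulrDr.
  congr (expR (- (b * _))).
  rewrite (bigD1 i)//= [in RHS](bigD1 i)//= !mxE !eqxx mulr1.
  rewrite [in RHS](eq_bigr (fun j => x ord0 j ^+ 2)); first by ring.
  by move=> j /negbTE ji; rewrite !mxE ji andbF mulr0 add0r.
apply: is_derive_eq; rewrite /GRing.scale/= !mul0r mulr0 expr0n/= mulr0n.
by rewrite !(mul0r, mulr0, add0r, addr0, oppr0, expR0); ring.
Qed.

Lemma expr_expRN_bounded b (k : nat) : 0 < b ->
  exists M : R, forall u : R, `|u ^+ k| * expR (- (b * u ^+ 2)) <= M.
Proof.
(* From one term of the exponential series, [u^(2k+2) <= C * exp (b u^2)]. This dominates [|u|^k]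
   when [|u| > 1]; the summand 1 of the bound covers [|u| <= 1]. *)
move=> b0; pose C : R := (k.+1)`!%:R / b ^+ k.+1.
exists (1 + C) => u; rewrite expRN ler_pdivrMr ?expR_gt0//.
have bu0 : 0 <= b * u ^+ 2 by rewrite mulr_ge0 ?sqr_ge0// ltW.
have C0 : 0 <= C by rewrite divr_ge0// exprn_ge0// ltW.
have uC : (u ^+ 2) ^+ k.+1 <= C * expR (b * u ^+ 2).
  have := expR_ge1Dxn k bu0.
  rewrite exprMn => H.
  rewrite /C mulrAC ler_pdivlMr ?exprn_gt0// mulrC.
  rewrite -ler_pdivrMl ?ltr0n ?fact_gt0// mulrC.
  apply: le_trans H; rewrite [leLHS]mulrC [X in X / _ <= _]mulrC.
  by rewrite lerDr.
rewrite mulrDl mul1r; have [u1|u1] := leP `|u| 1.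
  apply: (@le_trans _ _ 1).
    by rewrite normrX exprn_ile1.
  have e1 : 1 <= expR (b * u ^+ 2) by rewrite -[leLHS]expR0 ler_expR.
  by rewrite (le_trans e1)// lerDl mulr_ge0// expR_ge0.
apply: (@le_trans _ _ (C * expR (b * u ^+ 2))); last by rewrite lerDr expR_ge0.
apply: le_trans uC.
rewrite normrX -(real_normK (num_real u)) -exprM.
by apply: ler_weXn2l; [exact: ltW|rewrite mulnS mul2n -addnn addnA leq_addl].
Qed.

Lemma gauss_decaying b : 0 < b -> decaying (gauss b).
Proof.
move=> b0; split; first exact: gauss_continuous.
move=> a.
have H i := cid (expr_expRN_bounded (a i) b0).
exists (\prod_i projT1 (H i)) => x.
rewrite gauss_prod /monomial -big_split/= normr_prod.
apply: ler_prod => i _; rewrite normr_ge0/= normrM (ger0_norm (expR_ge0 _)).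
exact: (projT2 (H i)).
Qed.

Lemma ge0_integral_gauss b x : 0 < b ->
  (\int[mu]_z (gauss b (z - x))%:E = (Num.sqrt (pi / b) ^+ n)%:E)%E.
Proof.
(* With [2 * s^2 = 1 / b], each one-dimensional factor is [sqrt (pi / b)] times the normal density
   of mean [x_i] and standard deviation [s]. *)
move=> b0; pose s : R := Num.sqrt ((2 * b)^-1).
have b20 : 0 < (2 * b)^-1 by rewrite invr_gt0 mulr_gt0.
have s0 : s != 0 by rewrite gt_eqF// sqrtr_gt0.
have s2 : s ^+ 2 = (2 * b)^-1 by rewrite sqr_sqrtr// ltW.
have pdfE m t : expR (- (b * (t - m) ^+ 2)) = Num.sqrt (pi / b) * normal_pdf m s t.
  rewrite normal_pdfE//= /normal_peak /normal_fun s2.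
  have -> : (2 * b)^-1 * pi *+ 2 = pi / b by field; rewrite gt_eqF.
  rewrite mulVKf; last first.
    by rewrite gt_eqF// sqrtr_gt0 divr_gt0// pi_gt0.
  by congr expR; field; rewrite gt_eqF.
under eq_integral => z _.
  rewrite gauss_prod; under eq_bigr do rewrite !mxE.
  over.
rewrite (ge0_integral_prod_rV (h := fun i t => expR (- (b * (t - x ord0 i) ^+ 2)))).
- rewrite -[X in (_ ^+ X)%:E](card_ord n) -prodr_const -prodEFin.
  apply: eq_bigr => i _; under eq_integral do rewrite pdfE EFinM.
  rewrite ge0_integralZl//.
  + by rewrite integral_normal_pdf mule1.
  + by apply/measurable_EFinP; exact: measurable_normal_pdf.
  + by move=> t _; rewrite lee_fin normal_pdf_ge0.
- move=> i; under eq_fun do rewrite pdfE.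
  by apply: measurable_funM => //; exact: measurable_normal_pdf.
- by move=> i t; exact: expR_ge0.
Qed.

Lemma integral_gauss b x : 0 < b ->
  \int[mu]_z gauss b (z - x) = Num.sqrt (pi / b) ^+ n.
Proof. by move=> b0; rewrite /Rintegral ge0_integral_gauss. Qed.

Lemma integrable_gauss b x : 0 < b ->
  mu.-integrable setT (EFin \o (fun z => gauss b (z - x))).
Proof.
move=> b0; apply/integrableP; split.
  apply/measurable_EFinP; apply: continuous_rV_measurable => z.
  apply: (continuous_comp (f := fun z => z - x)); last exact: gauss_continuous.
  by apply: continuousB; [move=> A|exact: cst_continuous].
under eq_integral do rewrite /= ger0_norm ?expR_ge0//.
by rewrite ge0_integral_gauss// ltry.
Qed.

(** Differentiating the transform brings out [x_i * gauss], which is proportional to a derivative of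
    [gauss]; integrating by parts then returns the same transform with phase raised by [pi], that
    is, negated. The equation is [d_i T = - y_i / (2 b) * T]. *)
Lemma cosT_gauss phi b y : 0 < b ->
  cosT phi (gauss b) y =
  cos phi * Num.sqrt (pi / b) ^+ n * gauss (4 * b)^-1 y.
Proof.
move=> b0; have dg := gauss_decaying b0.
pose T := cosT phi (gauss b).
have dT i x : is_derive x (delta_mx ord0 i) T (- (x ord0 i / (2 * b) * T x)).
  apply: (is_derive_eq (is_derive_cosT phi i x dg)).
  have dgd : decaying (fun z => - (2 * b) * xmul i (gauss b) z).
    exact/decayingZ/decaying_xmul.
  have dgi z : is_derive z (delta_mx ord0 i) (gauss b) (- (2 * b) * xmul i (gauss b) z).
    by apply: (is_derive_eq (is_derive_gauss b i z)); rewrite /xmul; ring.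
  have := cosT_parts (phi + pi / 2) x dgi dg dgd.
  rewrite cosTZ; last exact: decaying_xmul.
  rewrite /T; have -> : cosT (phi + pi / 2 + pi / 2) (gauss b) x = - cosT phi (gauss b) x.
    rewrite -mulN1r -cosTZ// /cosT; apply: eq_Rintegral => z _.
    by rewrite !addrA !cosDpihalf sinDpihalf; ring.
  move=> E; apply: (mulfI (_ : 2 * b != 0)); first by rewrite gt_eqF ?mulr_gt0.
  rewrite -[LHS]opprK -[X in - X]mulNr -[X in - (X)]opprK -E.
  by field; rewrite gt_eqF.
(* [T] times its integrating factor has zero partial derivatives, so it equals its value at the
   origin. *)
pose Q x := T x * gauss (- (4 * b)^-1) x.
have Qc : Q y = Q 0.
  apply/eqP; rewrite -subr_eq0 -normr_le0.
  rewrite -(mul0r (\sum_i `|y ord0 i - (0 : 'rV_n) ord0 i|)).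
  apply: (partial_lipschitz (df := fun=> fun=> 0)); last by move=> *; rewrite normr0.
  move=> i x; apply: (is_derive_eq (is_deriveM (dT i x) (is_derive_gauss _ i x))).
  by rewrite /GRing.scale/=; field; rewrite gt_eqF.
have T0 : T 0 = cos phi * Num.sqrt (pi / b) ^+ n.
  rewrite /T /cosT -(integral_gauss 0 b0) -RintegralZl//; last exact: integrable_gauss.
  apply: eq_Rintegral => z _; rewrite subr0 mulrC; congr (cos _ * _).
  by rewrite /dotrV big1 ?add0r// => i _; rewrite mxE mul0r.
have gN x : gauss (- (4 * b)^-1) x * gauss (4 * b)^-1 x = 1.
  by rewrite /gauss -expRD mulNr opprK subrr expR0.
rewrite -T0; move: Qc; rewrite /Q.
have -> : gauss (- (4 * b)^-1) (0 : 'rV_n) = 1.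
  by rewrite /gauss big1 ?mulr0 ?oppr0 ?expR0// => i _; rewrite mxE expr0n.
rewrite mulr1 => <-.
by rewrite -mulrA gN mulr1.
Qed.

End gaussian.

(** * Adjunction and inversion *)

Section inversion.
Context {R : realType} {n : nat}.
Implicit Types (f g h : 'rV[R]_n -> R) (x y z : 'rV[R]_n) (i : 'I_n).
Local Notation mu := (lebesgue_rV n).

(** The Hartley kernel with the sign of the sine reversed. *)
Definition cas y x : R := cos (dotrV y x) - sin (dotrV y x).

Lemma casC y x : cas y x = cas x y.
Proof. by rewrite /cas dotrVC. Qed.

Lemma cas_bound y x : `|cas y x| <= 2.
Proof.
by rewrite (le_trans (ler_normB _ _))// -[2]/(1 + 1) lerD ?cos_max ?sin_max.
Qed.

Lemma cas_continuous y : continuous (cas y).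
Proof.
move=> x; apply: continuousB.
  apply: (continuous_comp (f := dotrV y)); first exact: dotrV_continuous.
  exact: continuous_cos.
apply: (continuous_comp (f := dotrV y)); first exact: dotrV_continuous.
exact: continuous_sin.
Qed.

Lemma decayingM_cas y h : decaying h -> decaying (fun x => h x * cas y x).
Proof.
by apply: (decayingM_bounded (K := 2)) => [|x]; [exact: cas_continuous|exact: cas_bound].
Qed.

Lemma measurable_cas : measurable_fun [set: 'rV[R]_n * 'rV[R]_n] (fun p => cas p.2 p.1).
Proof.
have md : measurable_fun [set: 'rV[R]_n * 'rV[R]_n] (fun p => dotrV p.2 p.1).
  apply: measurable_sum => i; apply: measurable_funM.
    exact: (measurableT_comp (measurable_coor_rV i) measurable_snd).
  exact: (measurableT_comp (measurable_coor_rV i) measurable_fst).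
apply: measurable_funB.
  apply: measurableT_comp md.
  by apply: continuous_measurable_fun; exact: continuous_cos.
apply: measurableT_comp md.
by apply: continuous_measurable_fun; exact: continuous_sin.
Qed.

(** The majorant [2 |f| |h|] separates the variables, so its double integral is a product of two
    finite ones. *)
Lemma integrable_cas f h : decaying f -> decaying h ->
  (mu \x mu)%E.-integrable setT
    (fun p => (f p.1 * (h p.2 * cas p.2 p.1))%:E).
Proof.
move=> df dh.
have mf : measurable_fun setT f by apply: continuous_rV_measurable; case: df.
have mh : measurable_fun setT h by apply: continuous_rV_measurable; case: dh.
have mf1 : measurable_fun [set: 'rV[R]_n * 'rV[R]_n] (fun p => f p.1).
  exact: (measurableT_comp mf measurable_fst).
have mh2 : measurable_fun [set: 'rV[R]_n * 'rV[R]_n] (fun p => h p.2).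
  exact: (measurableT_comp mh measurable_snd).
have mg : measurable_fun [set: 'rV[R]_n * 'rV[R]_n] (fun p => (2 * `|f p.1|) * `|h p.2|).
  apply: measurable_funM; last exact: measurableT_comp.
  by apply: measurable_funM => //; exact: measurableT_comp.
have gi : (mu \x mu)%E.-integrable setT (fun p => ((2 * `|f p.1|) * `|h p.2|)%:E).
  apply/integrable12ltyP => /=; first exact/measurable_EFinP.
  have nf : mu.-integrable setT (fun x => (2 * `|f x|)%:E).
    exact/integrable_EFinZ/integrable_norm/decaying_integrable.
  have nh : mu.-integrable setT (fun x => `|h x|%:E).
    exact/integrable_norm/decaying_integrable.
  have inner x : (\int[mu]_y `|(2 * `|f x| * `|h y|)%:E| =
      (2 * `|f x|)%:E * \int[mu]_y `|h y|%:E)%E.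
    under eq_integral do rewrite gee0_abs ?lee_fin ?mulr_ge0// EFinM.
    rewrite ge0_integralZl ?lee_fin ?mulr_ge0//.
    by apply/measurable_EFinP; exact: measurableT_comp.
  under eq_integral do rewrite inner.
  rewrite ge0_integralZr//; last 2 first.
  - exact: measurable_int nf.
  - by apply: integral_ge0 => x _; rewrite lee_fin.
  rewrite lte_mul_pinfty//.
  - by apply: integral_ge0 => x _; rewrite lee_fin mulr_ge0.
  - exact: integrable_fin_num.
  - by rewrite ltey_eq (integrable_fin_num measurableT nh).
apply: le_integrable gi => //.
  apply/measurable_EFinP; apply: measurable_funM => //.
  by apply: measurable_funM => //; exact: measurable_cas.
move=> [x z] _ /=; rewrite lee_fin !normrM !normr_id (ger0_norm (ler0n _ 2)).
rewrite (mulrC 2) -mulrA ler_wpM2l// mulrC ler_wpM2r//.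
exact: cas_bound.
Qed.

Lemma real_fourier_adjoint f h : decaying f -> decaying h ->
  \int[mu]_y (real_fourier f y * h y) = \int[mu]_x (f x * real_fourier h x).
Proof.
move=> df dh.
pose k x := fourier_const n * f x.
have dk : decaying k by exact: decayingZ.
have inner g1 c y : decaying g1 ->
    (\int[mu]_x (c * (g1 x * cas y x))%:E =
     (c * \int[mu]_x (g1 x * cas y x))%:E)%E.
  move=> /(decayingM_cas y)/decaying_integrable dg.
  rewrite EFinM fineK ?(integrable_fin_num measurableT dg)//.
  by under eq_integral do rewrite EFinM; rewrite (integralZl measurableT dg).
have := Fubini (integrable_cas dk dh) => /=.
under eq_integral do under eq_integral do rewrite casC.
under eq_integral do rewrite inner//.
under [in RHS]eq_integral do under eq_integral do rewrite mulrCA.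
under [in RHS]eq_integral do rewrite inner//.
move=> /(congr1 fine) FE; apply: etrans (esym (etrans _ FE)).
  apply: eq_Rintegral => y _; rewrite mulrC; congr (_ * _).
  rewrite /real_fourier -RintegralZl//; last exact/decaying_integrable/decayingM_cas.
  by apply: eq_Rintegral => x _; rewrite mulrA.
by apply: eq_Rintegral => x _; rewrite mulrCA mulrA.
Qed.

Lemma dotrVD y z x : dotrV (y + z) x = dotrV y x + dotrV z x.
Proof. by rewrite -big_split; apply: eq_bigr => i _; rewrite mxE mulrDl. Qed.

Lemma dotrVN y x : dotrV (- y) x = - dotrV y x.
Proof. by rewrite -sumrN; apply: eq_bigr => i _; rewrite mxE mulNr. Qed.

(** Shaped as two [cosT] kernels. The second, with phase [pi / 2], is odd in [y] and disappears
    against a Gaussian, in accordance with the factor [cos phi] in [cosT_gauss]. *)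
Lemma casM z x y :
  cas z y * cas x y = cos (dotrV (z - x) y + 0) + cos (dotrV (z + x) y + pi / 2).
Proof.
rewrite addr0 cosDpihalf !dotrVD dotrVN cosB sinD /cas; ring.
Qed.

Lemma real_fourier_gauss b x z : 0 < b ->
  real_fourier (fun y => gauss b y * cas x y) z =
  fourier_const n * Num.sqrt (pi / b) ^+ n * gauss (4 * b)^-1 (z - x).
Proof.
move=> b0; have dg := gauss_decaying (n := n) b0.
rewrite /real_fourier -/(fourier_const n) -mulrA; congr (_ * _).
have := cosT_gauss 0 (z - x) b0; rewrite cos0 mul1r => <-.
have E : cosT (pi / 2) (gauss b) (z + x) = 0 by rewrite cosT_gauss// cos_pihalf !mul0r.
rewrite -[RHS]addr0 -[X in _ = _ + X]E /cosT -RintegralD//; try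
  exact/decaying_integrable/decayingM_cos.
by apply: eq_Rintegral => y _; rewrite -/(cas z y) -mulrDr -casM; ring.
Qed.

(** Total mass 1 of the averaging density: [(2 pi)^(-n)] compensates the two Gaussian masses
    exactly. This is where the normalisation of the transform matters. *)
Lemma fourier_const_gauss b : 0 < b ->
  fourier_const n * (fourier_const n * Num.sqrt (pi / b) ^+ n) *
  Num.sqrt (pi / (4 * b)^-1) ^+ n = 1 :> R.
Proof.
move=> b0; have pi0 := pi_gt0 R.
have cc : fourier_const n * fourier_const n = ((2 * pi) ^+ n)^-1 :> R.
  by rewrite -invfM -expr2 sqr_sqrtr// exprn_ge0// mulr_ge0// ltW.
rewrite mulrA cc -mulrA -exprMn -sqrtrM; last by rewrite divr_ge0// ltW.
have -> : pi / b * (pi / (4 * b)^-1) = (2 * pi) ^+ 2 :> R.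
  by field; rewrite gt_eqF.
rewrite sqrtr_sqr ger0_norm ?mulr_ge0 ?ltW//.
by rewrite mulVf// expf_neq0// mulf_neq0// gt_eqF.
Qed.

(** Half of the exponent pays for the linear factor: exp(S / (8 e^2)) >= 1 + S / (8 e^2), and
    [2 e |v_i| <= v_i^2 + e^2] does the rest. *)
Lemma coord_gauss_le (e : R) (v : 'rV[R]_n) i : 0 < e ->
  `|v ord0 i| * gauss (4 * e ^+ 2)^-1 v <= 4 * e * gauss (8 * e ^+ 2)^-1 v.
Proof.
move=> e0; have e2 : 0 < 8 * e ^+ 2 by rewrite mulr_gt0 ?exprn_gt0.
have -> : gauss (4 * e ^+ 2)^-1 v = gauss (8 * e ^+ 2)^-1 v * gauss (8 * e ^+ 2)^-1 v.
  by rewrite /gauss -expRD; congr expR; field; rewrite gt_eqF.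
rewrite mulrA ler_wpM2r ?expR_ge0// /gauss expRN ler_pdivrMr ?expR_gt0//.
set S := \sum_i _.
have Si : v ord0 i ^+ 2 <= S.
  by rewrite /S (bigD1 i)//= lerDl sumr_ge0// => j _; exact: sqr_ge0.
apply: (@le_trans _ _ (4 * e * (1 + (8 * e ^+ 2)^-1 * S))); last first.
  by rewrite ler_wpM2l ?expR_ge1Dx// mulr_ge0// ltW.
rewrite -(ler_pM2l (_ : 0 < 2 * e)) ?mulr_gt0//.
have -> : 2 * e * (4 * e * (1 + (8 * e ^+ 2)^-1 * S)) = 8 * e ^+ 2 + S.
  by field; rewrite gt_eqF.
rewrite -(real_normK (num_real (v ord0 i))) in Si.
by have := sqr_ge0 (`|v ord0 i| - e); nra.
Qed.

Lemma gauss_approx g x : schwartz g -> exists A : R, forall e : R, 0 < e ->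
  `|fourier_const n * \int[mu]_y (real_fourier g y * (gauss (e ^+ 2) y * cas x y)) - g x|
  <= A * e.
Proof.
move=> sg; have dg := schwartz_decaying sg; have /schwartzE[smg decg] := sg.
have pgb i : exists M : R, forall z, `|partial i g z| <= M.
  have [_ /(_ (fun=> 0%N))[M hM]] := decg _ (ordered1 i).
  exists M => z; have := hM z.
  by rewrite /monomial; under eq_bigr do rewrite expr0; rewrite big1// mul1r.
pose L := \sum_i `|projT1 (cid (pgb i))|.
have gL z : `|g z - g x| <= L * \sum_i `|z ord0 i - x ord0 i|.
  apply: (partial_lipschitz (df := fun i => partial i g)).
    by move=> i u; exact: (smooth_is_derive [::] i u smg).
  move=> i u; apply: le_trans (projT2 (cid (pgb i)) u) _.
  rewrite /L (bigD1 i)//= (le_trans (ler_norm _))// lerDl.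
  exact: sumr_ge0.
have L0 : 0 <= L by exact: sumr_ge0.
(* [L] is the Lipschitz constant, [n] counts the coordinates, 4 comes from [coord_gauss_le], and
   [sqrt 2 ^ n] is the ratio of masses when the variance of the Gaussian doubles. *)
exists (L * (n%:R * (4 * Num.sqrt 2 ^+ n))) => e e0.
have b0 : 0 < e ^+ 2 by rewrite exprn_gt0.
have b4 : 0 < (4 * e ^+ 2)^-1 by rewrite invr_gt0 mulr_gt0.
have b8 : 0 < (8 * e ^+ 2)^-1 by rewrite invr_gt0 mulr_gt0.
pose C : R := fourier_const n * (fourier_const n * Num.sqrt (pi / e ^+ 2) ^+ n).
have C0 : 0 <= C.
  by rewrite !mulr_ge0 ?exprn_ge0 ?sqrtr_ge0 ?invr_ge0 ?sqrtr_ge0.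
(* [v] is the transform of the damped kernel given by [real_fourier_gauss]; [w], with the outer
   constant, is the probability density centred at [x]. *)
pose v z := fourier_const n * Num.sqrt (pi / e ^+ 2) ^+ n * gauss (4 * e ^+ 2)^-1 (z - x).
pose w z := C * gauss (4 * e ^+ 2)^-1 (z - x).
have wE z : w z = fourier_const n * v z by rewrite /w /C /v !mulrA.
have w0 z : 0 <= w z by rewrite mulr_ge0 ?gauss_ge0.
have iw : mu.-integrable setT (EFin \o w) by exact/integrable_EFinZ/integrable_gauss.
have Iw : \int[mu]_z w z = 1.
  by rewrite RintegralZl ?integral_gauss ?fourier_const_gauss//; exact: integrable_gauss.
have dgc : decaying (fun y => gauss (e ^+ 2) y * cas x y).
  exact/decayingM_cas/gauss_decaying.
have vC z : `|v z| <= fourier_const n * Num.sqrt (pi / e ^+ 2) ^+ n.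
  have c0 : 0 <= fourier_const n * Num.sqrt (pi / e ^+ 2) ^+ n :> R.
    by rewrite mulr_ge0 ?exprn_ge0 ?invr_ge0 ?sqrtr_ge0.
  rewrite ger0_norm; last by rewrite mulr_ge0 ?gauss_ge0.
  by rewrite /v ler_piMr// gauss_le1// ltW.
have cv : continuous v.
  apply: rV_continuousM; first exact: cst_continuous.
  move=> z; apply: (continuous_comp (f := fun z => z - x)); last exact: gauss_continuous.
  by apply: continuousB; [move=> ?|exact: cst_continuous].
have igv := decaying_integrable (decayingM_bounded cv vC dg).
have igw : mu.-integrable setT (EFin \o (fun z => g z * w z)).
  apply: eq_integrable (integrable_EFinZ (fourier_const n) igv) => // z _ /=.
  by rewrite wE mulrCA.
have igxw : mu.-integrable setT (EFin \o (fun z => g x * w z)) by exact: integrable_EFinZ.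
have -> : fourier_const n * \int[mu]_y (real_fourier g y * (gauss (e ^+ 2) y * cas x y))
    = \int[mu]_z (g z * w z).
  rewrite real_fourier_adjoint//; under eq_Rintegral do rewrite real_fourier_gauss//.
  rewrite -RintegralZl//.
  by apply: eq_Rintegral => z _; rewrite wE mulrCA.
rewrite -[X in _ - X]mulr1 -[X in _ - _ * X]Iw -RintegralZl// -RintegralB//.
have idw := integrable_EFinB igw igxw.
apply: (le_trans (le_normr_Rintegral _ idw)) => //.
pose u z := L * (n%:R * (4 * e * C)) * gauss (8 * e ^+ 2)^-1 (z - x).
have iu : mu.-integrable setT (EFin \o u) by exact/integrable_EFinZ/integrable_gauss.
apply: (@le_trans _ _ (\int[mu]_z u z)).
  apply: le_Rintegral => //; first exact: integrable_norm.
  move=> z _; rewrite -mulrBl normrM (ger0_norm (w0 z)).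
  apply: (@le_trans _ _ (L * (\sum_i `|z ord0 i - x ord0 i|) * w z)).
    by rewrite ler_wpM2r.
  rewrite -[leLHS]mulrA -[leRHS]mulrA ler_wpM2l// mulr_suml.
  apply: (@le_trans _ _ (\sum_(i < n) (4 * e * C * gauss (8 * e ^+ 2)^-1 (z - x)))).
    apply: ler_sum => i _; rewrite /w mulrCA [leRHS]mulrAC [leRHS]mulrC ler_wpM2l//.
    by have := coord_gauss_le (z - x) i e0; rewrite !mxE.
  rewrite sumr_const card_ord -[leLHS]mulr_natl.
  by rewrite le_eqVlt; apply/orP; left; apply/eqP; ring.
rewrite RintegralZl//; last exact: integrable_gauss.
rewrite integral_gauss//.
have -> : pi / (8 * e ^+ 2)^-1 = 2 * (pi / (4 * e ^+ 2)^-1) :> R by field; rewrite gt_eqF.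
rewrite sqrtrM// exprMn.
have := fourier_const_gauss b0; rewrite -/C => CE.
rewrite [leLHS](_ : _ = L * (n%:R * (4 * Num.sqrt 2 ^+ n)) * e *
  (C * Num.sqrt (pi / (4 * e ^+ 2)^-1) ^+ n)); last by ring.
by rewrite CE mulr1.
Qed.

Lemma real_fourierK g x : schwartz g -> real_fourier (real_fourier g) x = g x.
Proof.
move=> sg; have [A approx] := gauss_approx x sg.
have sG := schwartz_real_fourier sg; have dG := schwartz_decaying sG.
set G := real_fourier g.
pose q y := \sum_i y ord0 i ^+ 2 * G y.
have dq : decaying q.
  rewrite /q; elim: (index_enum _) => [|i s IHs].
    have := decayingZ 0 dG; congr decaying.
    by apply/funext => y; rewrite big_nil mul0r.
  under eq_fun do rewrite big_cons.
  apply: decayingD => //.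
  have := decaying_xmul i (decaying_xmul i dG); congr decaying.
  by apply/funext => y; rewrite /xmul mulrA.
have iq := integrable_norm (decaying_integrable dq).
pose c : R := fourier_const n.
have c0 : 0 <= c by rewrite invr_ge0 sqrtr_ge0.
(* [|q|] is [|y|^2 |G y|], the price of [1 - gauss]; the 2 bounds [cas]. *)
pose B : R := c * (2 * \int[mu]_y `|q y|).
have B0 : 0 <= B.
  by rewrite !mulr_ge0//; apply: Rintegral_ge0.
have damp (e : R) : 0 < e ->
    `|real_fourier G x - c * \int[mu]_y (G y * (gauss (e ^+ 2) y * cas x y))| <= B * e ^+ 2.
  move=> e0; have b0 : 0 < e ^+ 2 by rewrite exprn_gt0.
  have g01 y : 0 <= gauss (e ^+ 2) y <= 1.
    by rewrite gauss_ge0 gauss_le1// ltW.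
  have i1 := decaying_integrable (decayingM_cas x dG).
  have i2 : mu.-integrable setT (EFin \o (fun y => G y * (gauss (e ^+ 2) y * cas x y))).
    have dGg : decaying (fun y => G y * gauss (e ^+ 2) y).
      apply: (decayingM_bounded (K := 1)) => //; first exact: gauss_continuous.
      by move=> y; have /andP[? ?] := g01 y; rewrite ger0_norm.
    have := decaying_integrable (decayingM_cas x dGg).
    by apply: eq_integrable => // y _ /=; rewrite mulrA.
  rewrite /real_fourier -/(fourier_const n) -/c -mulrBr.
  rewrite normrM (ger0_norm c0) /B -mulrA ler_wpM2l//.
  rewrite -RintegralB//; have i12 := integrable_EFinB i1 i2.
  apply: (le_trans (le_normr_Rintegral _ i12)) => //.
  rewrite mulrAC -RintegralZl//.
  apply: le_Rintegral => //.
  - exact: integrable_norm.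
  - exact: integrable_EFinZ.
  move=> y _; have /andP[g0 g1] := g01 y.
  rewrite -/(cas x y) -mulrBr normrM.
  have -> : cas x y - gauss (e ^+ 2) y * cas x y = (1 - gauss (e ^+ 2) y) * cas x y by ring.
  rewrite (normrM (1 - _)) (ger0_norm (_ : 0 <= 1 - _)) ?subr_ge0//.
  have S0 : 0 <= \sum_i y ord0 i ^+ 2 by apply: sumr_ge0 => i _; exact: sqr_ge0.
  have -> : `|q y| = (\sum_i y ord0 i ^+ 2) * `|G y|.
    by rewrite /q -mulr_suml normrM ger0_norm.
  have ge : 1 - gauss (e ^+ 2) y <= e ^+ 2 * \sum_i y ord0 i ^+ 2.
    by rewrite lerBlDl -lerBlDr (le_trans _ (expR_ge1Dx _)).
  apply: (@le_trans _ _ (`|G y| * ((e ^+ 2 * \sum_i y ord0 i ^+ 2) * 2))).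
    by rewrite ler_wpM2l// ler_pM ?subr_ge0 ?cas_bound.
  by rewrite le_eqVlt; apply/orP; left; apply/eqP; ring.
apply/eqP; rewrite -subr_eq0 -normr_le0.
apply/ler_addgt0Pr => e e0; rewrite add0r.
(* Since [d <= 1], the error [B * d^2 + A * d] is at most [(B + |A|) * d], which is below [e]. *)
pose d : R := e / (B + `|A| + e).
have D0 : 0 < B + `|A| + e by rewrite ltr_wpDl// addr_ge0.
have d0 : 0 < d by rewrite divr_gt0.
have d1 : d <= 1 by rewrite ler_pdivrMr// mul1r lerDr addr_ge0.
rewrite -(subrKA (c * \int[mu]_y (G y * (gauss (d ^+ 2) y * cas x y)))).
apply: le_trans (ler_normD _ _) _.
apply: (@le_trans _ _ ((B + `|A|) * d)).
  rewrite mulrDl; apply: lerD.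
    by rewrite (le_trans (damp _ d0))// ler_wpM2l// expr2 ler_piMl// ltW.
  by rewrite (le_trans (approx _ d0))// ler_wpM2r ?ler_norm// ltW.
rewrite /d mulrA ler_pdivrMr// mulrC ler_wpM2l//; first exact: ltW.
by rewrite lerDl ltW.
Qed.

Lemma inner_product_real_fourier f g : schwartz f -> schwartz g ->
  inner_product (real_fourier f) (real_fourier g) = inner_product f g.
Proof.
move=> sf sg; rewrite /inner_product real_fourier_adjoint; last 2 first.
- exact: schwartz_decaying.
- exact/schwartz_decaying/schwartz_real_fourier.
by apply: eq_Rintegral => x _; rewrite real_fourierK.
Qed.

End inversion.

(* The first two clauses say that the real Fourier transform is a linear
   operator from the Schwartz space to itself. *)
Theorem proposition3 (R : realType) (n : nat) (hn : (1 <= n)%N) :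
  [/\ (forall f : 'rV[R]_n -> R, schwartz f -> schwartz (real_fourier f)),
      (forall (a : R) (f g : 'rV[R]_n -> R), schwartz f -> schwartz g ->
         forall y : 'rV[R]_n,
           real_fourier (fun x => a * f x + g x) y =
           a * real_fourier f y + real_fourier g y),
      (forall f g : 'rV[R]_n -> R, schwartz f -> schwartz g ->
         inner_product (real_fourier f) (real_fourier g) = inner_product f g),
      (forall f : 'rV[R]_n -> R, schwartz f ->
         norm2 (real_fourier f) = norm2 f) &
      (forall f g : 'rV[R]_n -> R, schwartz f -> schwartz g ->
         norm2 (fun y => real_fourier f y - real_fourier g y) =
         norm2 (fun x => f x - g x))].
Proof.
split.
- by move=> f; exact: schwartz_real_fourier.
- by move=> a f g sf sg y; apply: real_fourier_linear; exact: schwartz_decaying.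
- by move=> f g; exact: inner_product_real_fourier.
- by move=> f sf; rewrite /norm2 inner_product_real_fourier.
- move=> f g sf sg; rewrite /norm2.
  (* The difference in the form [a * f + g] that [schwartzD] and [real_fourier_linear] accept. *)
  have subE (u v : 'rV[R]_n -> R) : (fun x => u x - v x) = (fun x => - 1 * v x + u x).
    by apply/funext => x; rewrite mulN1r addrC.
  have sd : schwartz (fun x => - 1 * g x + f x) by exact: schwartzD.
  rewrite !subE -(inner_product_real_fourier sd sd).
  congr (Num.sqrt (inner_product _ _)); apply/funext => y;
    by rewrite real_fourier_linear//; exact: schwartz_decaying.
Qed.
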